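(* Let $\mathbb{X}$ be a Polish space, $\varepsilon>0$, and $c:\mathbb{X}\times\mathbb{X}\to\mathbb{R}\cup\{+\infty\}$ a debiasable cost with inf-representation $(\mathcal{Z},\psi)$, i.e. $c(x,y)=\inf_{z\in\mathcal{Z}}\psi(x,z)+\psi(y,z)$, where $\mathcal{Z}$ is a Polish space and $\psi:\mathbb{X}\times\mathcal{Z}\to\mathbb{R}\cup\{+\infty\}$ is measurable. Let $k(x,y):=e^{-c(x,y)/\varepsilon}$. Assume that there exist a probability measure $\lambda\in\mathcal{P}(\mathcal{Z})$, with $\int_{\mathcal{Z}}e^{-2\psi(x,z)/\varepsilon}\,d\lambda(z)<+\infty$ for all $x\in\mathbb{X}$, and a function $f:\mathbb{X}\to(0,+\infty]$, which may depend on $\lambda$ and $\varepsilon$, such that for all $x,y\in\mathbb{X}$ $$k(x,y)=\frac{1}{f(x)f(y)}\int_{\mathcal{Z}}e^{-\frac{\psi(x,z)+\psi(y,z)}{\varepsilon}}\,d\lambda(z).$$ Then, with $c_{\varepsilon,\lambda}(x,y):=-\varepsilon\log\int_{\mathcal{Z}}e^{-\frac{\psi(x,z)+\psi(y,z)}{\varepsilon}}\,d\lambda(z)$, for all $\mu,\nu\in\mathcal{P}(\mathbb{X})$, $$\mathrm{OT}^\varepsilon_c(\mu,\nu)=\mathrm{OT}^\varepsilon_{c_{\varepsilon,\lambda}}(\mu,\nu)+\varepsilon\int_{\mathbb{X}}\log f\,d\mu+\varepsilon\int_{\mathbb{X}}\log f\,d\nu$$ $$=\varepsilon\int_{\mathbb{X}}\log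 f\,d\mu+\varepsilon\int_{\mathbb{X}}\log f\,d\nu+\inf_{\eta\in\mathcal{P}(\mathcal{Z})}\mathrm{OT}^\varepsilon_\psi(\mu,\eta)+\mathrm{OT}^\varepsilon_\psi(\nu,\eta)+\varepsilon\,\mathrm{KL}(\eta|\lambda),$$ and $\mathrm{OT}^\varepsilon_c$ is debiasable.
   Context: A symmetric function $C:\mathcal{X}\times\mathcal{X}\to\mathbb{R}\cup\{+\infty\}$ is debiasable if $C(x,y)-\tfrac12C(x,x)-\tfrac12C(y,y)\ge0$ for all $x,y\in\mathcal{X}$, with the rule $\infty-\infty=+\infty$. $\mathcal{P}$: Borel probability measures; $\Pi(\mu,\eta)$: couplings. $\mathrm{KL}(\mu|\nu)=\int\log\frac{d\mu}{d\nu}\,d\mu$ if $\mu\ll\nu$, $+\infty$ otherwise. For measurable $b$ on $\mathbb{X}\times\mathbb{Y}$ ($\mathbb{Y}=\mathbb{X}$ or $\mathcal{Z}$), $\mathrm{OT}^\varepsilon_b(\mu,\eta)=\inf_{\pi\in\Pi(\mu,\eta)}\int b\,d\pi+\varepsilon\,\mathrm{KL}(\pi|\mu\otimes\eta)$. All functions are Borel and all integrals, sums and infima are assumed well defined in $\mathbb{R}\cup\{+\infty\}$. *)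

(* Defs.v *)
From HB Require Import structures.
From mathcomp Require Import all_boot all_order all_algebra.
From mathcomp Require Import all_classical all_reals all_analysis.
From mathcomp Require Import measurable_realfun.
Set Implicit Arguments.
Unset Strict Implicit.
Unset Printing Implicit Defensive.
Import Order.TTheory GRing.Theory Num.Theory.
Import numFieldNormedType.Exports.
Local Open Scope classical_set_scope.
Local Open Scope ring_scope.
Local Open Scope ereal_scope.

(* Functions with values in R U {+oo} are represented by functions into \bar R
   that avoid -oo. *)

(* A metric is only asked to exist, as everything below depends on the topology
   alone. *)
Definition completely_metrizable (R : realType) (T : topologicalType) : Prop :=
  exists dist : T -> T -> R,
    [/\ (forall x y, (0 <= dist x y)%R),
        (forall x y, dist x y = 0%R <-> x = y),
        (forall x y, dist x y = dist y x),
        (forall x y z, (dist x z <= dist x y + dist y z)%R)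
      & (forall x (A : set T), nbhs x A <->
           exists2 e : R, (0 < e)%R & [set y | (dist x y < e)%R] `<=` A) /\
        (forall u : nat -> T,
           (forall e : R, (0 < e)%R -> exists N, forall m n : nat,
              (N <= m)%N -> (N <= n)%N -> (dist (u m) (u n) < e)%R) ->
           exists l : T, u @ \oo --> l)].

Definition polish (R : realType) (T : topologicalType) : Prop :=
  (exists2 D : set T, countable D & dense D) /\ completely_metrizable R T.

(* On Polish spaces the product of the Borel sigma-algebras, which the library
   puts on [borel X * borel Y], is the Borel sigma-algebra of the product. *)
Notation borel T := (g_sigma_algebraType (@open T)).

Section debiasable.
Context {R : realType} {T : Type}.

(* The dual addition of [ereal_dual_scope] satisfies +oo - +oo = +oo. *)
Definition debiasable (C : T -> T -> \bar R) : Prop :=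
  [/\ (forall x y, C x y != -oo),
      (forall x y, C x y = C y x)
    & (forall x y,
        0 <= C x y - (2^-1)%:E * C x x - (2^-1)%:E * C y y)%dE].

Definition inf_representation {Z : Type} (psi : T -> Z -> \bar R)
    (c : T -> T -> \bar R) : Prop :=
  forall x y, c x y = ereal_inf [set psi x z + psi y z | z in [set: Z]].

End debiasable.

Definition gibbs_kernel {R : realType} {T : Type} (eps : R)
    (c : T -> T -> \bar R) (x y : T) : \bar R :=
  expeR (- (eps^-1%:E * c x y)).

Definition well_defined_integral d (T : measurableType d) (R : realType)
    (mu : {measure set T -> \bar R}) (f : T -> \bar R) : Prop :=
  \int[mu]_x (f^\- x) < +oo.

Definition KL d (T : measurableType d) (R : realType)
    (mu nu : probability T R) : \bar R :=
  if `[< mu `<< nu >] then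
    \int[mu]_x lne (Radon_Nikodym (charge_of_finite_measure mu) nu x)
  else +oo.

Section entropic_transport.
Context {dX dY : measure_display} {X : measurableType dX}
  {Y : measurableType dY} {R : realType}.

Definition jointly_measurable (b : X -> Y -> \bar R) : Prop :=
  measurable_fun [set: X * Y] (fun p => b p.1 p.2).

Definition couplings (mu : probability X R) (eta : probability Y R) :
    set (probability (X * Y)%type R) :=
  [set pi | (forall A, measurable A -> pi (fst @^-1` A) = mu A) /\
            (forall B, measurable B -> pi (snd @^-1` B) = eta B)].

Definition OT (eps : R) (b : X -> Y -> \bar R)
    (mu : probability X R) (eta : probability Y R) : \bar R :=
  ereal_inf [set \int[pi]_p b p.1 p.2 + eps%:E * KL pi (mu \x eta)
            | pi in couplings mu eta].

Definition OT_well_defined (eps : R) (b : X -> Y -> \bar R)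
    (mu : probability X R) (eta : probability Y R) : Prop :=
  (forall pi, couplings mu eta pi ->
     well_defined_integral pi (fun p => b p.1 p.2)) /\
  OT eps b mu eta != -oo.

End entropic_transport.

Section soft_cost.
Context {X : Type} {d : measure_display} {Z : measurableType d} {R : realType}.

Definition soft_cost (eps : R) (psi : X -> Z -> \bar R)
    (lambda : probability Z R) (x y : X) : \bar R :=
  - (eps%:E *
     lne (\int[lambda]_z expeR (- (eps^-1%:E * (psi x z + psi y z))))).

End soft_cost.

(* The requirement that the quantities in the two formulas for the pair
   (mu, nu) make sense in R U {+oo}. The same property of [c], of its transport
   cost and of the infimum over eta is not required, since it follows. *)
Definition well_posed {dX dZ : measure_display} {X : measurableType dX}
    {Z : measurableType dZ} {R : realType} (eps : R) (psi : X -> Z -> \bar R)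
    (lambda : probability Z R) (f : X -> \bar R) (mu nu : probability X R) :
    Prop :=
  [/\ well_defined_integral mu (fun x => lne (f x)),
      well_defined_integral nu (fun x => lne (f x)),
      OT_well_defined eps (soft_cost eps psi lambda) mu nu
    & forall eta : probability Z R,
        OT_well_defined eps psi mu eta /\ OT_well_defined eps psi nu eta].

(* Main.v *)
From HB Require Import structures.
Require Import Defs.
From mathcomp Require Import all_boot all_order all_algebra.
From mathcomp Require Import all_classical all_reals all_analysis.
From mathcomp Require Import measurable_realfun.
From mathcomp Require Import ring lra.
Import Order.TTheory GRing.Theory Num.Theory.
Import numFieldNormedType.Exports.
Local Open Scope classical_set_scope.
Local Open Scope ring_scope.
Local Open Scope ereal_scope.

(** Write [W = exp (- (psi x z + psi y z) / eps)] and [J x y] for its integral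
    against [lambda], so that the soft cost is [s = - eps log J].  The
    factorization of [k] says that [c x y = s x y + eps log f x + eps log f y]
    pointwise, and the integral of the two potentials against a coupling of
    [mu] and [nu] depends on [mu] and [nu] only: this is the first formula.

    For the second one, consider a law [Q] of triples [(x, y, z)], with marginals
    [pi] on [(x, y)], [m1] on [(x, z)], [m2] on [(y, z)] and [eta] on [z], and
    write [g], [p1], [p2], [h] for the densities of [pi], [m1], [m2], [eta] with
    respect to [mu x nu], [mu x eta], [nu x eta], [lambda].  Relative to
    [mu x nu x lambda] there are two natural densities of total mass at most 1
    built from these: [p1 p2 h], for which [x] and [y] are independent given [z], and
    [g W / J], for which [z] has the Gibbs law given [(x, y)].  The logarithm of
    their quotient, integrated against [Q], is [1 / eps] times the difference of

        [int psi dm1 + int psi dm2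
           + eps (KL m1 (mu x eta) + KL m2 (nu x eta) + KL eta lambda)]

    and [int s dpi + eps KL pi (mu x nu)], whatever the density of [Q] is.  By
    Gibbs' inequality (lemma [gibbs_inequality]) this integral is nonnegative
    when [Q] has the first density, and nonpositive when [Q] has the second one.
    - Given [m1] and [m2] with the same marginal [eta], the first choice glues
      them ([gluing], [soft_le_split]); its [pi] is a competitor for the soft
      transport problem.
    - Given [pi], the second choice lifts it to triples ([split_le_soft]); its
      marginals are competitors for the problem with latent law [eta].
    All the laws of finite entropy have densities, so that conditional laws are
    quotients of densities and Fubini's theorem computes the marginals.

    Taking infima gives the second formula ([OT_soft_cost]), which presents the
    transport cost as [inf_eta (F mu eta + F nu eta)]; since its diagonal is
    [2 inf_eta (F mu eta)], it is debiasable ([inf_sum_debiasable]). *)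

Set Implicit Arguments.
Unset Strict Implicit.
Unset Printing Implicit Defensive.

(** * Integrals of functions with an integrable negative part *)

Section quasi_integrable.
Context d (T : measurableType d) (R : realType).
Variable m : {measure set T -> \bar R}.
Implicit Types f g : T -> \bar R.

Lemma ae_le_integral f g :
  measurable_fun setT f -> measurable_fun setT g ->
  {ae m, forall x, f x <= g x} -> \int[m]_x f x <= \int[m]_x g x.
Proof.
move=> mf mg fg; rewrite [leLHS]integralE [leRHS]integralE; apply: leeB.
  apply: ae_ge0_le_integral => //; try exact: measurable_funepos.
  apply: filterS fg => x fg _; rewrite !funeposE ge_max !le_max fg/= lexx.
  by rewrite orbT.
apply: ae_ge0_le_integral => //; try exact: measurable_funeneg.
apply: filterS fg => x fg _; rewrite !funenegE ge_max !le_max leeN2 fg/= lexx.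
by rewrite orbT.
Qed.

Lemma well_defined_integral_ge0 f :
  (forall x, 0 <= f x) -> well_defined_integral m f.
Proof.
move=> f0; rewrite /well_defined_integral integral0_eq// => x _.
by rewrite (@ge0_funenegE _ _ setT)// inE.
Qed.

Lemma well_defined_integral_neqNy f :
  well_defined_integral m f -> \int[m]_x f x != -oo.
Proof.
move=> wf; rewrite integralE.
have : 0 <= \int[m]_x f^\+ x by exact: integral_ge0.
have : 0 <= \int[m]_x f^\- x by exact: integral_ge0.
move: wf; rewrite /well_defined_integral.
by case: (\int[m]_x f^\- x) => // r; case: (\int[m]_x f^\+ x).
Qed.

Lemma well_defined_integralD f g :
  measurable_fun setT f -> measurable_fun setT g ->
  well_defined_integral m f -> well_defined_integral m g ->
  well_defined_integral m (fun x => f x + g x).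
Proof.
move=> mf mg wf wg; rewrite /well_defined_integral.
apply: (@le_lt_trans _ _ (\int[m]_x (f^\- x + g^\- x))).
  apply: ge0_le_integral => //.
  - exact/measurable_funeneg/emeasurable_funD.
  - by apply: emeasurable_funD; exact: measurable_funeneg.
  move=> x _; rewrite !funenegE.
  case: (f x) => [a| |]; case: (g x) => [b| |];
    rewrite /= ?maxNye ?maxye ?addye ?addey ?leey// -?EFin_max ?lee_fin//;
    rewrite ?addr0 ?add0r ?le_max ?lexx ?orbT//.
  rewrite ge_max; apply/andP; split; last by rewrite addr_ge0// le_max lexx orbT.
  by rewrite opprD lerD// le_max lexx.
rewrite ge0_integralD//; try exact: measurable_funeneg.
exact: lte_add_pinfty.
Qed.

(* Pointwise, [f^+ <= (f + g)^+ + g^-]. *)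
Let integral_pos_pinfty f g :
  measurable_fun setT f -> measurable_fun setT g ->
  well_defined_integral m g ->
  \int[m]_x f^\+ x = +oo -> \int[m]_x (fun x => f x + g x)^\+ x = +oo.
Proof.
move=> mf mg wg foo; apply/eqP; rewrite eq_le leey/= leNgt; apply/negP => fgoo.
suff : \int[m]_x f^\+ x < +oo by rewrite foo.
apply: (@le_lt_trans _ _
  (\int[m]_x ((fun x => f x + g x)^\+ x + g^\- x))); last first.
  rewrite ge0_integralD//.
  - exact: lte_add_pinfty.
  - exact/measurable_funepos/emeasurable_funD.
  - exact: measurable_funeneg.
apply: ge0_le_integral => //.
- exact: measurable_funepos.
- apply: emeasurable_funD; last exact: measurable_funeneg.
  exact/measurable_funepos/emeasurable_funD.
- move=> x _; rewrite !funeposE !funenegE.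
  case: (f x) => [a| |]; case: (g x) => [b| |];
    rewrite /= ?maxNye ?maxye ?addye ?addey ?leey ?adde0// -?EFin_max -?EFinD;
    rewrite ?lee_fin ?add0r ?le_max ?lexx ?orbT//.
  rewrite ge_max addr_ge0 ?le_max ?lexx ?orbT//= andbT.
  have [h|h] := lerP (a + b) 0; rewrite ?add0r.
    by rewrite le_max; apply/orP; left; lra.
  by rewrite -lerBlDl le_max; apply/orP; left; lra.
Qed.

Lemma well_defined_integrableP f :
  measurable_fun setT f -> well_defined_integral m f ->
  \int[m]_x f^\+ x < +oo -> m.-integrable setT f.
Proof.
move=> mf wf fp; apply/integrableP; split => //.
under eq_integral do rewrite -/((abse \o f) _) fune_abse.
rewrite ge0_integralD//.
- exact: lte_add_pinfty.
- exact: measurable_funepos.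
- exact: measurable_funeneg.
Qed.

Lemma well_defined_integral_fin_num f :
  measurable_fun setT f -> well_defined_integral m f -> \int[m]_x f x < +oo ->
  {ae m, forall x, f x \is a fin_num}.
Proof.
move=> mf wf fy.
have /(integrable_ae measurableT) : m.-integrable setT f.
  apply: well_defined_integrableP => //; move: fy; rewrite integralE.
  have : 0 <= \int[m]_x f^\- x by exact: integral_ge0.
  move: wf; rewrite /well_defined_integral.
  case: (\int[m]_x f^\- x) => [r| |]// _ _.
  by case: (\int[m]_x f^\+ x) => [s| |]//=; rewrite ?ltry ?ltNyr ?ltxx.
by apply: filterS => x /(_ I).
Qed.

(** Either both functions are integrable, or one of the positive parts has an
    infinite integral, which the finite negative parts cannot compensate. *)
Lemma integralD_well_defined f g :
  measurable_fun setT f -> measurable_fun setT g ->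
  well_defined_integral m f -> well_defined_integral m g ->
  \int[m]_x (f x + g x) = \int[m]_x f x + \int[m]_x g x.
Proof.
move=> mf mg wf wg.
have pinfty h : well_defined_integral m h -> \int[m]_x h^\+ x = +oo ->
    \int[m]_x h x = +oo.
  move=> wh hoo; rewrite integralE hoo.
  have : 0 <= \int[m]_x h^\- x by exact: integral_ge0.
  by move: wh; rewrite /well_defined_integral; case: (\int[m]_x h^\- x).
have [foo|fb] := eqVneq (\int[m]_x f^\+ x) +oo.
  rewrite (pinfty f)// addye ?well_defined_integral_neqNy//.
  by apply: pinfty; [exact: well_defined_integralD|exact: integral_pos_pinfty].
have [goo|gb] := eqVneq (\int[m]_x g^\+ x) +oo.
  rewrite (pinfty g)// addey ?well_defined_integral_neqNy//.
  under eq_integral do rewrite addeC.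
  by apply: pinfty; [exact: well_defined_integralD|exact: integral_pos_pinfty].
by rewrite integralD//; apply: well_defined_integrableP => //; rewrite ltey.
Qed.

Lemma integral_gt0Zl f (k : R) : (0 < k)%R -> measurable_fun setT f ->
  \int[m]_x (k%:E * f x) = k%:E * \int[m]_x f x.
Proof.
move=> k0 mf; rewrite integralE [in RHS]integralE.
rewrite ge0_funeposM ?ge0_funenegM ?ltW//.
rewrite !ge0_integralZl ?lee_fin ?ltW//;
  [|exact: measurable_funeneg|exact: measurable_funepos].
have : 0 <= \int[m]_x f^\+ x by exact: integral_ge0.
have : 0 <= \int[m]_x f^\- x by exact: integral_ge0.
case: (\int[m]_x f^\+ x) => [a| |]//; case: (\int[m]_x f^\- x) => [b| |]// _ _.
- by rewrite -!EFinM mulrBr.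
- by rewrite gt0_muley ?lte_fin//= gt0_muleNy ?lte_fin.
- by rewrite gt0_muley ?lte_fin.
- by rewrite gt0_muley ?lte_fin//= gt0_muleNy ?lte_fin.
Qed.

Lemma well_defined_integralZl f (k : R) : (0 < k)%R -> measurable_fun setT f ->
  well_defined_integral m f -> well_defined_integral m (fun x => k%:E * f x).
Proof.
move=> k0 mf wf; rewrite /well_defined_integral ge0_funenegM ?ltW//.
rewrite ge0_integralZl ?lee_fin ?ltW//; last exact: measurable_funeneg.
by apply: lte_mul_pinfty => //; rewrite lee_fin ltW.
Qed.

End quasi_integrable.

Section marginals.
Context d d' (T : measurableType d) (U : measurableType d') (R : realType).
Variables (m : {measure set T -> \bar R}) (m' : {measure set U -> \bar R}).
Variable phi : T -> U.
Hypothesis mphi : measurable_fun setT phi.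
Hypothesis m'E : forall A, measurable A -> m (phi @^-1` A) = m' A.
Implicit Types f : U -> \bar R.

Lemma ge0_integral_image f : measurable_fun setT f -> (forall y, 0 <= f y) ->
  \int[m']_y f y = \int[m]_x f (phi x).
Proof.
move=> mf f0; rewrite (eq_measure_integral (pushforward m phi)).
  by rewrite ge0_integral_pushforward.
by move=> A mA _; exact/esym/m'E.
Qed.

Lemma integral_image f : measurable_fun setT f ->
  \int[m']_y f y = \int[m]_x f (phi x).
Proof.
move=> mf; rewrite integralE [RHS]integralE.
rewrite ge0_integral_image//; last exact: measurable_funepos.
rewrite (@ge0_integral_image f^\-)//; last exact: measurable_funeneg.
by congr (_ - _); apply: eq_integral => x _; rewrite ?funeposE ?funenegE.
Qed.

Lemma well_defined_integral_image f : measurable_fun setT f ->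
  well_defined_integral m' f -> well_defined_integral m (fun x => f (phi x)).
Proof.
move=> mf; rewrite /well_defined_integral ge0_integral_image//;
  last exact: measurable_funeneg.
by apply: le_lt_trans; rewrite le_eqVlt; apply/orP; left; apply/eqP;
  apply: eq_integral => x _; rewrite !funenegE.
Qed.

End marginals.

(** * Densities and relative entropy *)

Lemma measurable_preimageT d d' (T : measurableType d) (U : measurableType d')
    (phi : T -> U) A :
  measurable_fun setT phi -> measurable A -> measurable (phi @^-1` A).
Proof. by move=> mphi mA; rewrite -[X in measurable X]setTI; exact: mphi. Qed.

(** Measurability may be checked on real arguments, as the two infinite points
    form a measurable set. *)
Lemma measurable_ereal_fun (R : realType) (F : \bar R -> \bar R) :
  measurable_fun [set: R] (F \o EFin) -> measurable_fun [set: \bar R] F.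
Proof.
move=> mF.
have -> : F = fun x => if x \is a fin_num then F (fine x)%:E else
    if x == +oo then F +oo else F -oo.
  by apply/funext => -[].
apply: measurable_fun_ifT.
- apply: (measurable_fun_bool true); rewrite setTI.
  have := emeasurable_fin_num (@measurableT _ (\bar R)) (@measurable_id _ _ setT).
  by rewrite setTI.
- exact: (measurableT_comp mF (fine_measurable _)).
- apply: measurable_fun_ifT => //; apply: (measurable_fun_bool true).
  rewrite setTI [X in measurable X](_ : _ = [set +oo]); first exact: emeasurable_set1.
  by apply/seteqP; split => x /= /eqP.
Qed.

Lemma measurable_lne (R : realType) : measurable_fun setT (@lne R).
Proof.
apply: measurable_ereal_fun; apply: measurable_fun_ifT => //=.
  exact: measurable_fun_ler.
by apply/measurable_EFinP; exact: measurable_ln.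
Qed.

Lemma measurable_expeR (R : realType) : measurable_fun setT (@expeR R).
Proof.
apply: measurable_ereal_fun.
by apply/measurable_EFinP; exact: measurable_expR.
Qed.

Section densities.
Context d (T : measurableType d) (R : realType).
Implicit Types m n : probability T R.

(** Densities are real and nonnegative everywhere, not almost everywhere, so that
    pointwise inequalities between them need no exceptional set. *)
Definition density (m n : set T -> \bar R) (p : T -> R) : Prop :=
  [/\ measurable_fun setT p, forall x, (0 <= p x)%R
    & forall A, measurable A -> m A = \int[n]_(x in A) (p x)%:E].

Lemma dominates_measure0 m n : 
  (forall A, measurable A -> n A = 0 -> m A = 0) -> m `<< n.
Proof. by move=> h; apply/null_content_dominatesP. Qed.

(** The relative entropy is defined with a signed version of the
    Radon-Nikodym derivative; it may be computed with a nonnegative one. *)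
Lemma KL_density m n : m `<< n ->
  exists2 p, density m n p & KL m n = \int[m]_x lne (p x)%:E.
Proof.
move=> mn; pose g := Radon_Nikodym_SigmaFinite.f m n.
have g0 := Radon_Nikodym_SigmaFinite.f_ge0 mn.
have gfin := Radon_Nikodym_SigmaFinite.f_fin_num mn.
have gint := Radon_Nikodym_SigmaFinite.f_integrable mn.
have mg : measurable_fun setT g by exact: measurable_int gint.
exists (fun x => fine (g x)).
  split.
  - exact: measurableT_comp.
  - by move=> x; apply: fine_ge0; exact: g0.
  - move=> A mA; rewrite (Radon_Nikodym_SigmaFinite.f_integral mn)//.
    by apply: eq_integral => x _; rewrite fineK//; exact: gfin.
rewrite /KL; case: asboolP => // _.
have /ae_eq_sym [N [mN nN sN]] :=
  ae_eq_Radon_Nikodym_SigmaFinite mn (@measurableT _ T).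
have mRN : measurable_fun setT
    (Radon_Nikodym (charge_of_finite_measure m) n).
  exact: measurable_int (Radon_Nikodym_integrable _).
apply: ae_eq_integral => //.
- exact: (measurableT_comp (@measurable_lne R)).
- apply: (measurableT_comp (@measurable_lne R)); apply/measurable_EFinP.
  exact: measurableT_comp.
exists N; split => //; first by move/null_content_dominatesP : mn; exact.
move=> x /= xN; apply: sN => /= /(_ I) e; apply: xN => _.
by rewrite e -[in LHS](fineK (gfin x)).
Qed.

Section density_theory.
Variables (m n : probability T R) (p : T -> R).
Hypothesis mp : density m n p.

Lemma density_dominates : m `<< n.
Proof.
case: mp => measp p0 mE; apply: dominates_measure0 => A mA nA.
rewrite mE//; apply: null_set_integral => //.
by apply/measurable_EFinP; exact: measurable_funTS.
Qed.

(** The change of variables is known for the Radon-Nikodym derivative, and any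
    density agrees with it almost everywhere. *)
Lemma integral_density f : measurable_fun setT f -> (forall x, 0 <= f x) ->
  \int[m]_x f x = \int[n]_x (f x * (p x)%:E).
Proof.
move=> mf f0; have mn := density_dominates; case: mp => measp p0 mE.
rewrite -(Radon_Nikodym_SigmaFinite.change_of_variables mn)//.
have gint := Radon_Nikodym_SigmaFinite.f_integrable mn.
have mg : measurable_fun setT (Radon_Nikodym_SigmaFinite.f m n).
  exact: measurable_int gint.
have mep : measurable_fun setT (EFin \o p) by exact/measurable_EFinP.
apply: ae_eq_integral => //; [exact: emeasurable_funM..|].
apply: ae_eqe_mul2l; apply: integral_ae_eq => // A _ mA.
by rewrite -mE// -(Radon_Nikodym_SigmaFinite.f_integral mn).
Qed.

Lemma density_ae_gt0 : {ae m, forall x, (0 < p x)%R}.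
Proof.
case: mp => measp p0 mE.
exists [set x | p x = 0%R]; split.
- exact: (measurable_preimageT measp (measurable_set1 0%R)).
- rewrite mE; last exact: (measurable_preimageT measp (measurable_set1 0%R)).
  by apply: integral0_eq => x /= ->.
- move=> x /= /negP; rewrite -leNgt => px0.
  by apply/eqP; rewrite eq_le px0 p0.
Qed.

End density_theory.

Lemma probability_of_density n (p : T -> R) :
  measurable_fun setT p -> (forall x, (0 <= p x)%R) ->
  \int[n]_x (p x)%:E = 1 -> exists m : probability T R, density m n p.
Proof.
move=> measp p0 p1.
pose m0 := fun A : set T => \int[n]_(x in A) (p x)%:E.
have m00 : m0 set0 = 0 by rewrite /m0 integral_set0.
have m0_ge0 A : 0 <= m0 A by apply: integral_ge0 => x _; rewrite lee_fin.
have m0_sa : semi_sigma_additive m0.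
  move=> /= A mA tA mUA.
  rewrite /m0 ge0_integral_bigcup//=; last 2 first.
  - by apply/measurable_EFinP; exact: measurable_funTS.
  - by move=> x _; rewrite lee_fin.
  by apply: is_cvg_ereal_nneg_natsum_cond => k _ _; exact: m0_ge0.
pose mix1 := isMeasure.Build d T R m0 m00 m0_ge0 m0_sa.
pose m1 : {measure set T -> \bar R} := HB.pack m0 mix1.
have m1T : m1 setT = 1 by [].
pose mix2 := Measure_isProbability.Build d T R m1 m1T.
pose m2 : probability T R := HB.pack m0 mix1 mix2.
by exists m2; split.
Qed.

End densities.

(** * Gibbs' inequality *)

Lemma ln_le_subr1 (R : realType) (t : R) : (0 < t)%R -> (ln t <= t - 1)%R.
Proof.
move=> t0; rewrite -{1}(subrKC 1%R t) le_ln1Dx//; lra.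
Qed.

Section gibbs.
Context d (T : measurableType d) (R : realType).
Implicit Types (m n Q M : probability T R) (p a : T -> R).

Lemma integral_probability_cst m (k : \bar R) : \int[m]_x k = k.
Proof.
by rewrite (@integral_cst _ _ _ m setT)// [X in _ * X](probability_setT m) mule1.
Qed.

Lemma expeRN_lne (r : R) : (0 < r)%R -> expeR (- lne r%:E) = (r^-1)%:E.
Proof. by move=> r0; rewrite lne_EFin//= expRN lnK. Qed.

(** Only an inequality, because [b] may have mass where [a] vanishes.  The factor
    [expeR (- lne a)] is [1 / a], with the value [+oo] where [a = 0]; it is used
    since its measurability is that of [expeR] and [lne]. *)
Lemma integral_div_density Q M a (b : T -> \bar R) :
  density Q M a -> measurable_fun setT b -> (forall x, 0 <= b x) ->
  \int[Q]_x (b x * expeR (- lne (a x)%:E)) <= \int[M]_x b x.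
Proof.
move=> Qa mb b0; case: (Qa) => ma a0 _.
have mla : measurable_fun setT (fun x => expeR (- lne (a x)%:E)).
  apply: (measurableT_comp (@measurable_expeR R)).
  apply: (measurableT_comp (@oppe_measurable _ _)).
  apply: (measurableT_comp (@measurable_lne R)).
  exact/measurable_EFinP.
rewrite (integral_density Qa)//; last first.
- by move=> x; rewrite mule_ge0// expeR_ge0.
- exact: emeasurable_funM.
apply: ge0_le_integral => //.
- by move=> x _; rewrite !mule_ge0// ?expeR_ge0// lee_fin.
- by apply: emeasurable_funM; [exact: emeasurable_funM|exact/measurable_EFinP].
move=> x _; have := a0 x; rewrite le_eqVlt => /predU1P[<-|ax0].
  by rewrite mule0.
by rewrite expeRN_lne// -muleA -EFinM mulVf ?mule1// gt_eqF.
Qed.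

(** The negative part of [log p] is at most [1 / p], whose integral against
    [m = p n] is at most 1. *)
Lemma well_defined_lne_density m n p : density m n p ->
  well_defined_integral m (fun x => lne (p x)%:E).
Proof.
move=> mp; case: (mp) => measp p0 _.
have ml : measurable_fun setT (fun x => lne (p x)%:E).
  by apply: (measurableT_comp (@measurable_lne R)); exact/measurable_EFinP.
apply: (@le_lt_trans _ _ (\int[m]_x (1 * expeR (- lne (p x)%:E)))).
  apply: ge0_le_integral => //.
  - exact: measurable_funeneg.
  - apply: emeasurable_funM => //.
    apply: (measurableT_comp (@measurable_expeR R)).
    exact: (measurableT_comp (@oppe_measurable _ _)).
  move=> x _; rewrite mul1e funenegE ge_max expeR_ge0 andbT.
  by apply: le_trans (expeR_ge1Dx _); rewrite leeDr.
apply: le_lt_trans (@integral_div_density m n p (cst 1) mp _ _) _ => //.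
by rewrite integral_probability_cst ltry.
Qed.

(** Gibbs' inequality [0 <= KL Q (b M)], for a density [a] of [Q] and a
    subprobability density [b]: where [U - V] is at least [eps * log (a / b)]
    the bound [log t <= t - 1] gives the hypothesis, and [b / a] has integral at
    most 1 against [Q].  Asking for this pointwise bound instead of the value of
    [U - V] lets both functions take infinite values. *)
Lemma gibbs_inequality (eps : R) Q M a (b U V : T -> \bar R) :
  (0 < eps)%R -> density Q M a ->
  measurable_fun setT b -> (forall x, 0 <= b x) -> \int[M]_x b x <= 1 ->
  measurable_fun setT U -> measurable_fun setT V ->
  well_defined_integral Q U -> well_defined_integral Q V ->
  (forall x, (0 < a x)%R ->
     V x + eps%:E <= U x + eps%:E * (b x * ((a x)^-1)%:E)) ->
  \int[Q]_x V x <= \int[Q]_x U x.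
Proof.
move=> e0 Qa mb b0 b1 mU mV wU wV UV; case: (Qa) => ma a0 _.
pose E x := b x * expeR (- lne (a x)%:E).
have E0 x : 0 <= E x by rewrite mule_ge0// expeR_ge0.
have mE : measurable_fun setT E.
  apply: emeasurable_funM => //.
  apply: (measurableT_comp (@measurable_expeR R)).
  apply: (measurableT_comp (@oppe_measurable _ _)).
  apply: (measurableT_comp (@measurable_lne R)).
  exact/measurable_EFinP.
have E1 : \int[Q]_x E x <= 1.
  exact: le_trans (integral_div_density Qa mb b0) b1.
have weps : well_defined_integral Q (cst eps%:E).
  by apply: well_defined_integral_ge0 => x; rewrite lee_fin ltW.
have mEe : measurable_fun setT (fun x => eps%:E * E x).
  exact: emeasurable_funM.
have : \int[Q]_x (V x + cst eps%:E x) <= \int[Q]_x (U x + eps%:E * E x).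
  apply: ae_le_integral; [exact: emeasurable_funD..|].
  apply: filterS (density_ae_gt0 Qa) => x ax0.
  by rewrite /E expeRN_lne//; exact: UV.
rewrite !integralD_well_defined//; last first.
  by apply: well_defined_integralZl => //; exact: well_defined_integral_ge0.
rewrite integral_gt0Zl// integral_probability_cst => h.
have {}h : \int[Q]_x V x + eps%:E <= \int[Q]_x U x + eps%:E.
  apply: le_trans h _; apply: leeD => //.
  by rewrite -[leRHS]mule1 lee_pmul2l ?lte_fin.
by rewrite leeD2rE in h.
Qed.

Lemma integral_lne_density_ge0 m n p : density m n p ->
  0 <= \int[m]_x lne (p x)%:E.
Proof.
move=> mp; case: (mp) => measp p0 _.
have := @gibbs_inequality 1 m n p (cst 1) (fun x => lne (p x)%:E) (cst 0) ltr01 mp.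
rewrite integral0; apply => //.
- by rewrite integral_probability_cst.
- by apply: (measurableT_comp (@measurable_lne R)); exact/measurable_EFinP.
- exact: well_defined_lne_density mp.
- exact: well_defined_integral_ge0.
move=> x px0; rewrite lne_EFin// !mul1e add0e -EFinD lee_fin.
have := @ln_le_subr1 R (p x)^-1; rewrite invr_gt0 px0 lnV// => /(_ isT); lra.
Qed.

Lemma KL_ge0 m n : 0 <= KL m n.
Proof.
have [mn|mn] := pselect (m `<< n); last first.
  by rewrite /KL; case: asboolP.
by have [p mp ->] := KL_density mn; exact: integral_lne_density_ge0 mp.
Qed.

End gibbs.

(** * Product measures and gluing of couplings *)

Lemma integral_indicator d (T : measurableType d) (R : realType)
    (m : {measure set T -> \bar R}) (A : set T) (f : T -> \bar R) :
  \int[m]_(x in A) f x = \int[m]_x (f x * (\1_A x)%:E).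
Proof. by rewrite integral_mkcond epatch_indic. Qed.

Lemma measurable_indicator d (T : measurableType d) (R : realType) (A : set T) :
  measurable A -> measurable_fun setT (fun x => (\1_A x : R)%:E).
Proof. by move=> mA; apply/measurable_EFinP; exact: measurable_indic. Qed.

Lemma integral_indicatorT d (T : measurableType d) (R : realType)
    (m : {measure set T -> \bar R}) (A : set T) : measurable A ->
  \int[m]_x (\1_A x)%:E = m A.
Proof. by move=> mA; rewrite integral_indic// setIT. Qed.

Lemma measurable_integral_fst dT dZ (T : measurableType dT)
    (Z : measurableType dZ) (R : realType) (rho : probability T R)
    (f : T * Z -> \bar R) :
  measurable_fun setT f -> (forall t, 0 <= f t) ->
  measurable_fun setT (fun z => \int[rho]_x f (x, z)).
Proof. by move=> mf f0; exact: (measurable_fun_fubini_tonelli_G f mf f0). Qed.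

Lemma integral_product_snd dT dZ (T : measurableType dT)
    (Z : measurableType dZ) (R : realType) (rho : probability T R)
    (eta : probability Z R) (f : T * Z -> \bar R) :
  measurable_fun setT f -> (forall t, 0 <= f t) ->
  \int[rho \x eta]_t f t = \int[eta]_z \int[rho]_x f (x, z).
Proof. by move=> mf f0; rewrite fubini_tonelli2. Qed.

Lemma measurable_integral_snd dT dZ (T : measurableType dT)
    (Z : measurableType dZ) (R : realType) (eta : probability Z R)
    (f : T * Z -> \bar R) :
  measurable_fun setT f -> (forall t, 0 <= f t) ->
  measurable_fun setT (fun x => \int[eta]_z f (x, z)).
Proof. by move=> mf f0; exact: (measurable_fun_fubini_tonelli_F f mf f0). Qed.

Lemma integral_product_fst dT dZ (T : measurableType dT)
    (Z : measurableType dZ) (R : realType) (rho : probability T R)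
    (eta : probability Z R) (f : T * Z -> \bar R) :
  measurable_fun setT f -> (forall t, 0 <= f t) ->
  \int[rho \x eta]_t f t = \int[rho]_x \int[eta]_z f (x, z).
Proof. by move=> mf f0; rewrite fubini_tonelli1. Qed.

Section density_product.
Context dT dZ (T : measurableType dT) (Z : measurableType dZ) (R : realType).

Lemma density_product_snd (rho : probability T R) (eta lambda : probability Z R)
    (h : Z -> R) : density eta lambda h ->
  density (rho \x eta) (rho \x lambda) (h \o snd).
Proof.
move=> hd; case: (hd) => mh h0 _.
have mh2 : measurable_fun setT (fun t : T * Z => (h t.2)%:E).
  by apply/measurable_EFinP; exact: measurableT_comp.
split; first exact: measurableT_comp.
  by move=> t; exact: h0.
move=> A mA; rewrite -integral_indicatorT// [RHS]integral_indicator.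
have mI := @measurable_indicator _ _ R _ mA.
rewrite [RHS]integral_product_snd//=; last 2 first.
- exact: emeasurable_funM.
- by move=> t; rewrite mule_ge0// lee_fin.
rewrite [LHS]integral_product_snd//=.
rewrite (integral_density hd)//; last 2 first.
- by apply: (measurable_integral_fst rho mI) => t; rewrite lee_fin.
- by move=> z; apply: integral_ge0 => x _; rewrite lee_fin.
apply: eq_integral => z _; rewrite /fubini_G muleC -ge0_integralZl//=.
- exact: (measurable_fun_pair1 z mI).
- by rewrite lee_fin.
Qed.

End density_product.

Section conditional_product.
Context dX dZ (X : measurableType dX) (Z : measurableType dZ) (R : realType).
Variables mu nu : probability X R.

Definition xz (t : (X * X) * Z) : X * Z := (t.1.1, t.2).
Definition yz (t : (X * X) * Z) : X * Z := (t.1.2, t.2).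

Lemma measurable_xz : measurable_fun setT xz.
Proof.
apply: measurable_fun_pair => //.
exact: (measurableT_comp measurable_fst measurable_fst).
Qed.

Lemma measurable_yz : measurable_fun setT yz.
Proof.
apply: measurable_fun_pair => //.
exact: (measurableT_comp measurable_snd measurable_fst).
Qed.

(** In the law [mu x nu x eta] of triples, functions of [(x, z)] and of [(y, z)]
    are independent given [z]. *)
Lemma integral_conditional_product (eta : probability Z R)
    (F G : X * Z -> \bar R) :
  measurable_fun setT F -> (forall t, 0 <= F t) ->
  measurable_fun setT G -> (forall t, 0 <= G t) ->
  \int[(mu \x nu) \x eta]_t (F (xz t) * G (yz t)) =
  \int[eta]_z (\int[mu]_x F (x, z) * \int[nu]_y G (y, z)).
Proof.
move=> mF F0 mG G0.
have mFG : measurable_fun setT (fun t => F (xz t) * G (yz t)).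
  by apply: emeasurable_funM; apply: measurableT_comp => //;
    [exact: measurable_xz|exact: measurable_yz].
rewrite (integral_product_snd (mu \x nu) eta mFG); last by move=> t; rewrite mule_ge0.
apply: eq_integral => z _.
have mFz : measurable_fun setT (fun x => F (x, z)) by exact: measurable_fun_pair1.
have mGz : measurable_fun setT (fun y => G (y, z)) by exact: measurable_fun_pair1.
rewrite fubini_tonelli1//; last 2 first.
- exact: (measurable_fun_pair1 z mFG).
- by move=> t; rewrite mule_ge0.
rewrite -ge0_integralZr//; last exact: integral_ge0.
apply: eq_integral => x _.
by rewrite /fubini_F/= -ge0_integralZl.
Qed.

Lemma product_measure_xz (eta : probability Z R) A : measurable A ->
  ((mu \x nu) \x eta) (xz @^-1` A) = (mu \x eta) A.
Proof.
move=> mA; have mI := @measurable_indicator _ _ R _ mA.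
rewrite -integral_indicatorT; last exact: measurable_preimageT measurable_xz mA.
rewrite -[RHS]integral_indicatorT//.
have := integral_conditional_product eta mI _ (measurable_cst 1) (fun=> lee01).
rewrite (integral_product_snd mu eta)// => H.
transitivity
  (\int[(mu \x nu) \x eta]_t ((\1_A (xz t))%:E * (cst 1 (yz t) : \bar R))).
  by apply: eq_integral => t _; rewrite mule1.
rewrite H//; apply: eq_integral => z _.
by rewrite (integral_probability_cst nu) mule1.
Qed.

Lemma product_measure_yz (eta : probability Z R) A : measurable A ->
  ((mu \x nu) \x eta) (yz @^-1` A) = (nu \x eta) A.
Proof.
move=> mA; have mI := @measurable_indicator _ _ R _ mA.
rewrite -integral_indicatorT; last exact: measurable_preimageT measurable_yz mA.
rewrite -[RHS]integral_indicatorT//.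
have := integral_conditional_product eta (measurable_cst 1) (fun=> lee01) mI.
rewrite (integral_product_snd nu eta)// => H.
transitivity
  (\int[(mu \x nu) \x eta]_t ((cst 1 (xz t) : \bar R) * (\1_A (yz t))%:E)).
  by apply: eq_integral => t _; rewrite mul1e.
rewrite H//; apply: eq_integral => z _.
by rewrite (integral_probability_cst mu) mul1e.
Qed.

Lemma integral_coupling_density (mu' : probability X R) (eta : probability Z R)
    (m : probability (X * Z)%type R) p :
  couplings mu' eta m -> density m (mu' \x eta) p ->
  {ae eta, forall z, \int[mu']_x (p (x, z))%:E = 1}.
Proof.
move=> [_ m2] pd; case: (pd) => mp p0 mE.
have mep : measurable_fun setT (EFin \o p) by exact/measurable_EFinP.
have mG : measurable_fun setT (fun z => \int[mu']_x (p (x, z))%:E).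
  by apply: (measurable_integral_fst mu' mep) => t; rewrite lee_fin.
have : ae_eq eta setT (cst 1) (fun z => \int[mu']_x (p (x, z))%:E).
  apply: integral_ae_eq => //.
    apply/integrableP; split => //.
    rewrite (eq_integral (cst 1)); last by move=> x _; exact: abse1.
    by rewrite integral_probability_cst ltry.
  move=> C _ mC; rewrite integral_cst// mul1e.
  transitivity (m (@snd X Z @^-1` C)); first exact/esym/m2.
  have mC2 : measurable (@snd X Z @^-1` C).
    exact: measurable_preimageT measurable_snd mC.
  rewrite mE// [LHS]integral_indicator [RHS]integral_indicator.
  rewrite (integral_product_snd mu' eta)//; last 2 first.
  - apply: emeasurable_funM => //; exact: measurable_indicator.
  - by move=> t; rewrite mule_ge0 ?lee_fin.
  apply: eq_integral => z _; rewrite /= -ge0_integralZr//.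
  - exact: (measurable_fun_pair1 z mep).
  - by move=> x _; rewrite lee_fin.
by apply: filterS => z /(_ I) <-.
Qed.

(** The density [p1 p2] of the gluing: as [p2] integrates to 1 in [y] for almost
    every [z], integrating out [y] leaves [p1], and symmetrically. *)
Section gluing.
Variable eta : probability Z R.
Variables (m1 m2 : probability (X * Z)%type R) (p1 p2 : X * Z -> R).
Hypothesis c1 : couplings mu eta m1.
Hypothesis c2 : couplings nu eta m2.
Hypothesis d1 : density m1 (mu \x eta) p1.
Hypothesis d2 : density m2 (nu \x eta) p2.

Lemma integral_gluing_xz (F : X * Z -> \bar R) :
  measurable_fun setT F -> (forall t, 0 <= F t) ->
  \int[(mu \x nu) \x eta]_t (F (xz t) * (p1 (xz t) * p2 (yz t))%:E) =
  \int[m1]_t F t.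
Proof.
move=> mF F0; case: (d1) => mp1 p10 _; case: (d2) => mp2 p20 _.
have mep1 : measurable_fun setT (EFin \o p1) by exact/measurable_EFinP.
have mep2 : measurable_fun setT (EFin \o p2) by exact/measurable_EFinP.
have mFp : measurable_fun setT (fun t => F t * (p1 t)%:E).
  exact: emeasurable_funM.
have Fp0 t : 0 <= F t * (p1 t)%:E by rewrite mule_ge0 ?lee_fin.
under eq_integral do rewrite EFinM muleA.
rewrite (@integral_conditional_product eta (fun t => F t * (p1 t)%:E)
  (EFin \o p2))//.
rewrite (integral_density d1)// (integral_product_snd mu eta)//.
apply: ae_eq_integral => //.
- apply: emeasurable_funM; first exact: (measurable_integral_fst mu mFp).
  by apply: (measurable_integral_fst nu mep2) => t; rewrite lee_fin.
- exact: (measurable_integral_fst mu mFp).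
by apply: filterS (integral_coupling_density c2 d2) => z /= -> _; rewrite mule1.
Qed.

Lemma integral_gluing_yz (F : X * Z -> \bar R) :
  measurable_fun setT F -> (forall t, 0 <= F t) ->
  \int[(mu \x nu) \x eta]_t (F (yz t) * (p1 (xz t) * p2 (yz t))%:E) =
  \int[m2]_t F t.
Proof.
move=> mF F0; case: (d1) => mp1 p10 _; case: (d2) => mp2 p20 _.
have mep1 : measurable_fun setT (EFin \o p1) by exact/measurable_EFinP.
have mep2 : measurable_fun setT (EFin \o p2) by exact/measurable_EFinP.
have mFp : measurable_fun setT (fun t => F t * (p2 t)%:E).
  exact: emeasurable_funM.
have Fp0 t : 0 <= F t * (p2 t)%:E by rewrite mule_ge0 ?lee_fin.
under eq_integral do rewrite EFinM muleCA.
rewrite (@integral_conditional_product eta (EFin \o p1)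
  (fun t => F t * (p2 t)%:E))//.
rewrite (integral_density d2)// (integral_product_snd nu eta)//.
apply: ae_eq_integral => //.
- apply: emeasurable_funM; last exact: (measurable_integral_fst nu mFp).
  by apply: (measurable_integral_fst mu mep1) => t; rewrite lee_fin.
- exact: (measurable_integral_fst nu mFp).
by apply: filterS (integral_coupling_density c1 d1) => z /= -> _; rewrite mul1e.
Qed.

Lemma integral_gluing_density :
  \int[(mu \x nu) \x eta]_t (p1 (xz t) * p2 (yz t))%:E = 1.
Proof.
rewrite -(integral_probability_cst m1 1) -(@integral_gluing_xz (cst 1))//.
by apply: eq_integral => t _; rewrite mul1e.
Qed.

Lemma measurable_gluing_density :
  measurable_fun setT (fun t => (p1 (xz t) * p2 (yz t))%R).
Proof.
case: (d1) => mp1 _ _; case: (d2) => mp2 _ _.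
apply: measurable_funM; apply: measurableT_comp => //.
  exact: measurable_xz.
exact: measurable_yz.
Qed.

Lemma gluing : exists Q : probability ((X * X) * Z)%type R,
  [/\ density Q ((mu \x nu) \x eta) (fun t => p1 (xz t) * p2 (yz t))%R,
      (forall A, measurable A -> Q (xz @^-1` A) = m1 A)
    & (forall A, measurable A -> Q (yz @^-1` A) = m2 A)].
Proof.
case: (d1) => _ p10 _; case: (d2) => _ p20 _.
have [Q Qd] := probability_of_density measurable_gluing_density
  (fun t => mulr_ge0 (p10 (xz t)) (p20 (yz t))) integral_gluing_density.
case: (Qd) => _ _ QE.
exists Q; split => // A mA.
- rewrite QE; last exact: measurable_preimageT measurable_xz mA.
  rewrite integral_indicator -(integral_indicatorT m1)// -integral_gluing_xz//.
  + by apply: eq_integral => t _; rewrite muleC.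
  + exact: measurable_indicator.
- rewrite QE; last exact: measurable_preimageT measurable_yz mA.
  rewrite integral_indicator -(integral_indicatorT m2)// -integral_gluing_yz//.
  + by apply: eq_integral => t _; rewrite muleC.
  + exact: measurable_indicator.
Qed.

End gluing.
End conditional_product.
Arguments xz {dX dZ X Z}.
Arguments yz {dX dZ X Z}.

(** * The Gibbs law of the latent variable *)

Lemma fine_gt0_fin_num (R : realType) (x : \bar R) :
  (0 < fine x)%R -> exists2 r : R, (0 < r)%R & x = r%:E.
Proof. by case: x => [r| |]//=; [exists r|rewrite ltxx..]. Qed.

Section pointwise.
Variables (R : realType) (eps : R).
Hypothesis eps_gt0 : (0 < eps)%R.

(** For [s] the soft cost at [(x, y)], [A = psi x z] and [B = psi y z], this is
    [W / J], the density in [z] of the Gibbs law given [(x, y)].  Where [J = 0],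
    that is [s = +oo], it takes the value [+oo], except where [W = 0]. *)
Definition tilt (s A B : \bar R) : \bar R :=
  expeR (eps^-1%:E * s) * expeR (- (eps^-1%:E * (A + B))).

Let scaled_ln (t : R) : (0 < t)%R -> (eps * ln t + eps <= eps * t)%R.
Proof.
move=> t0; have := ln_le_subr1 t0.
by rewrite -(ler_pM2l eps_gt0); lra.
Qed.

Let tiltE (s A B : R) :
  tilt s%:E A%:E B%:E = (expR (eps^-1 * s - eps^-1 * (A + B)))%:E.
Proof. by rewrite /tilt/= -EFinM -expRD. Qed.

(** The hypothesis of Gibbs' inequality for [a = p q h] and [b = g W / J].  The
    value [+oo] of the tilt when [J = 0 < W] makes the bound hold there too. *)
Lemma tilt_le (s A B : \bar R) (p q h g : R) :
  s != -oo -> A != -oo -> B != -oo ->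
  (0 <= p)%R -> (0 <= q)%R -> (0 <= h)%R -> (0 <= g)%R -> (0 < p * q * h)%R ->
  s + eps%:E * lne g%:E + eps%:E <=
  A + B + eps%:E * lne p%:E + eps%:E * lne q%:E + eps%:E * lne h%:E
  + eps%:E * ((g%:E * tilt s A B) * (p * q * h)^-1%:E).
Proof.
move=> sN AN BN p0 q0 h0 g0 pqh.
have {}p0 : (0 < p)%R.
  by rewrite lt_neqAle p0 andbT; apply: contraTneq pqh => <-; rewrite !mul0r ltxx.
have {}q0 : (0 < q)%R.
  by rewrite lt_neqAle q0 andbT; apply: contraTneq pqh => <-;
    rewrite mulr0 mul0r ltxx.
have {}h0 : (0 < h)%R.
  by rewrite lt_neqAle h0 andbT; apply: contraTneq pqh => <-; rewrite mulr0 ltxx.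
have E0 : 0 <= eps%:E * ((g%:E * tilt s A B) * (p * q * h)^-1%:E).
  rewrite !mule_ge0 ?lee_fin ?expeR_ge0 ?invr_ge0// ?ltW//.
rewrite (lne_EFin p0) (lne_EFin q0) (lne_EFin h0).
have ABoo : A + B = +oo ->
    A + B + eps%:E * (ln p)%:E + eps%:E * (ln q)%:E + eps%:E * (ln h)%:E
    + eps%:E * ((g%:E * tilt s A B) * (p * q * h)^-1%:E) = +oo.
  move=> ->; rewrite -!EFinM !addye//.
  by apply: contraTneq E0 => ->.
have [ABy|ABy] := eqVneq (A + B) +oo; first by rewrite ABoo// leey.
case: A AN ABy E0 {ABoo} => [A| |]//; last by case: B BN.
case: B BN => [B| |]// _ _ _ E0.
move: g0; rewrite le_eqVlt => /predU1P[<-|g0].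
  by rewrite /= lexx gt0_muleNy ?lte_fin// addeNy addNye leNye.
rewrite (lne_EFin g0).
case: s sN E0 => [s| |]// _ _.
  rewrite tiltE -!(EFinM, EFinD) lee_fin.
  set k := expR _.
  have k0 : (0 < k)%R by exact: expR_gt0.
  have := @scaled_ln (g * k * (p * q * h)^-1).
  rewrite !mulr_gt0 ?invr_gt0// => /(_ isT).
  rewrite !lnM ?posrE ?mulr_gt0 ?invr_gt0// lnV ?posrE ?mulr_gt0//.
  rewrite !lnM ?posrE ?mulr_gt0// expRK.
  have -> : (eps * (ln g + (eps^-1 * s - eps^-1 * (A + B))
     - (ln p + ln q + ln h)) = s + eps * ln g -
     (A + B + eps * ln p + eps * ln q + eps * ln h))%R.
    by field; rewrite gt_eqF.
  lra.
rewrite /tilt gt0_muley ?lte_fin ?invr_gt0//=.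
rewrite gt0_mulye ?lte_fin ?expR_gt0// gt0_muley ?lte_fin//.
by rewrite gt0_mulye ?lte_fin ?invr_gt0// gt0_muley ?lte_fin//= leey.
Qed.

(** The same bound with [a] and [b] exchanged.  The density [a] has to be real, so
    the tilt is replaced by its finite part, which is 0 where [J = 0]. *)
Lemma tilt_ge (s A B : \bar R) (p q h g : R) :
  s != -oo -> A != -oo -> B != -oo ->
  (0 <= p)%R -> (0 <= q)%R -> (0 <= h)%R -> (0 <= g)%R ->
  (0 < g * fine (tilt s A B))%R ->
  A + B + eps%:E * lne p%:E + eps%:E * lne q%:E + eps%:E * lne h%:E + eps%:E <=
  s + eps%:E * lne g%:E
  + eps%:E * ((p * q * h)%:E * (g * fine (tilt s A B))^-1%:E).
Proof.
move=> sN AN BN p0 q0 h0 g0 gk.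
have {}g0 : (0 < g)%R.
  by rewrite lt_neqAle g0 andbT; apply: contraTneq gk => <-; rewrite mul0r ltxx.
move: (gk); rewrite pmulr_rgt0// => /fine_gt0_fin_num[k k0 kE].
have ABy : A + B != +oo.
  apply/eqP => AB; move: kE; rewrite /tilt AB gt0_muley ?lte_fin ?invr_gt0//=.
  by rewrite mule0 => -[kE]; rewrite -kE ltxx in k0.
case: A AN ABy kE gk => [A| |]//; last by case: B BN.
case: B BN => [B| |]// _ _ _.
case: s sN => [s| |]// _; last first.
  rewrite /tilt gt0_muley ?lte_fin ?invr_gt0//=.
  by rewrite gt0_mulye ?lte_fin ?expR_gt0.
rewrite tiltE => -[kE] _; rewrite /fine.
move: p0; rewrite le_eqVlt => /predU1P[<-|p0].
  by rewrite /= lexx gt0_muleNy ?lte_fin// addeNy !addNye leNye.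
move: q0; rewrite le_eqVlt => /predU1P[<-|q0].
  by rewrite /= lexx gt0_muleNy ?lte_fin// addeNy !addNye leNye.
move: h0; rewrite le_eqVlt => /predU1P[<-|h0].
  by rewrite /= lexx gt0_muleNy ?lte_fin// addeNy !addNye leNye.
rewrite !lne_EFin// -!(EFinM, EFinD) lee_fin.
move: kE; set k' := expR _ => kE.
have k'0 : (0 < k')%R by exact: expR_gt0.
have := @scaled_ln (p * q * h * (g * k')^-1).
rewrite !mulr_gt0 ?invr_gt0 ?mulr_gt0// => /(_ isT).
rewrite lnM ?posrE ?mulr_gt0 ?invr_gt0 ?mulr_gt0// lnV ?posrE ?mulr_gt0//.
rewrite !lnM ?posrE ?mulr_gt0// expRK.
have -> : (eps * (ln p + ln q + ln h -
    (ln g + (eps^-1 * s - eps^-1 * (A + B)))) =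
    (A + B + eps * ln p + eps * ln q + eps * ln h) - (s + eps * ln g))%R.
  by field; rewrite gt_eqF.
lra.
Qed.

End pointwise.

Section soft_kernel.
Context dX dZ (X : measurableType dX) (Z : measurableType dZ) (R : realType).
Variables (eps : R) (psi : X -> Z -> \bar R) (lambda : probability Z R).
Hypothesis eps_gt0 : (0 < eps)%R.
Hypothesis psi_meas : jointly_measurable psi.
Hypothesis psiNNy : forall x z, psi x z != -oo.
Hypothesis lambda_int : forall x,
  \int[lambda]_z expeR (- ((2 / eps)%:E * psi x z)) < +oo.

Let W (t : (X * X) * Z) : \bar R :=
  expeR (- (eps^-1%:E * (psi t.1.1 t.2 + psi t.1.2 t.2))).

Let J (x y : X) : \bar R :=
  \int[lambda]_z expeR (- (eps^-1%:E * (psi x z + psi y z))).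

Let epsV_gt0 : (0 < eps^-1)%R. Proof. by rewrite invr_gt0. Qed.

Lemma measurable_cost_xz : measurable_fun setT
  (fun t : (X * X) * Z => psi t.1.1 t.2).
Proof. exact: (measurableT_comp psi_meas (@measurable_xz _ _ X Z)). Qed.

Lemma measurable_cost_yz : measurable_fun setT
  (fun t : (X * X) * Z => psi t.1.2 t.2).
Proof. exact: (measurableT_comp psi_meas (@measurable_yz _ _ X Z)). Qed.

Let mW : measurable_fun setT W.
Proof.
apply: (measurableT_comp (@measurable_expeR R)).
apply: (measurableT_comp (@oppe_measurable _ _)).
apply: emeasurable_funM => //.
by apply: emeasurable_funD; [exact: measurable_cost_xz|exact: measurable_cost_yz].
Qed.

Let W_lty t : W t < +oo.
Proof.
rewrite /W ltey expeR_eqy.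
case: (psi t.1.1 t.2) (psiNNy t.1.1 t.2) => [A| |]//;
case: (psi t.1.2 t.2) (psiNNy t.1.2 t.2) => [B| |]// _ _;
by rewrite ?addey ?addye ?gt0_muley ?lte_fin.
Qed.

Let J_ge0 x y : 0 <= J x y.
Proof. by apply: integral_ge0 => z _; exact: expeR_ge0. Qed.

(** By [exp (- (a + b)) <= exp (- 2 a) + exp (- 2 b)], square integrability of
    [exp (- psi / eps)] is enough. *)
Let J_lty x y : J x y < +oo.
Proof.
have mpsi x' : measurable_fun setT
    (fun z => expeR (- ((2 / eps)%:E * psi x' z))).
  apply: (measurableT_comp (@measurable_expeR R)).
  apply: (measurableT_comp (@oppe_measurable _ _)).
  apply: emeasurable_funM => //.
  exact: (measurable_fun_pair2 x' psi_meas).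
apply: (@le_lt_trans _ _ (\int[lambda]_z (expeR (- ((2 / eps)%:E * psi x z)) +
    expeR (- ((2 / eps)%:E * psi y z))))); last first.
  rewrite ge0_integralD//.
  - exact: lte_add_pinfty.
  - by move=> z _; exact: expeR_ge0.
  - by move=> z _; exact: expeR_ge0.
apply: ge0_le_integral => //.
- by move=> z _; exact: expeR_ge0.
- exact: (measurable_fun_pair2 (x, y) mW).
- exact: emeasurable_funD.
move=> z _.
have e2 : (0 < 2 / eps :> R)%R by rewrite divr_gt0.
have [AB|AB] := eqVneq (psi x z + psi y z) +oo.
  by rewrite AB gt0_muley ?lte_fin//= adde_ge0// expeR_ge0.
case: (psi x z) (psiNNy x z) AB => [A| |]//; last by case: (psi y z) (psiNNy y z).
case: (psi y z) (psiNNy y z) => [B| |]// _ _ _.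
rewrite /= lee_fin.
have [ab|ab] := leP A B.
  apply: le_trans (_ : expR (- (2 / eps * A)) <= _)%R; last first.
    by rewrite lerDl expR_ge0.
  rewrite ler_expR lerN2 -subr_ge0.
  have -> : (eps^-1 * (A + B) - 2 / eps * A = eps^-1 * (B - A))%R by ring.
  by rewrite mulr_ge0 ?subr_ge0// ltW.
apply: le_trans (_ : expR (- (2 / eps * B)) <= _)%R; last first.
  by rewrite lerDr expR_ge0.
rewrite ler_expR lerN2 -subr_ge0.
have -> : (eps^-1 * (A + B) - 2 / eps * B = eps^-1 * (A - B))%R by ring.
by rewrite mulr_ge0 ?subr_ge0// ltW.
Qed.

Lemma soft_cost_neqNy x y : soft_cost eps psi lambda x y != -oo.
Proof.
rewrite /soft_cost -/(J x y); case: (J x y) (J_lty x y) => [r| |]// _.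
  rewrite /=; case: ifPn => // _.
  by rewrite gt0_muleNy ?lte_fin.
by rewrite /= gt0_muleNy ?lte_fin.
Qed.

Lemma measurable_soft_cost : measurable_fun setT
  (fun t : X * X => soft_cost eps psi lambda t.1 t.2).
Proof.
apply: (measurableT_comp (@oppe_measurable _ _)).
apply: emeasurable_funM => //.
apply: (measurableT_comp (@measurable_lne R)).
have /= := @measurable_fun_fubini_tonelli_F _ _ _ _ R lambda W mW
  (fun t => expeR_ge0 _).
by apply: eq_measurable_fun => -[x y].
Qed.

Definition tilted (t : (X * X) * Z) : \bar R :=
  tilt eps (soft_cost eps psi lambda t.1.1 t.1.2) (psi t.1.1 t.2) (psi t.1.2 t.2).

Lemma tilted_ge0 t : 0 <= tilted t.
Proof. by rewrite mule_ge0// expeR_ge0. Qed.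

Lemma measurable_tilted : measurable_fun setT tilted.
Proof.
apply: emeasurable_funM; last exact: mW.
apply: (measurableT_comp (@measurable_expeR R)).
apply: emeasurable_funM => //.
exact: (measurableT_comp measurable_soft_cost measurable_fst).
Qed.

Let expeR_soft x y :
  expeR (eps^-1%:E * soft_cost eps psi lambda x y) = expeR (- lne (J x y)).
Proof.
rewrite /soft_cost -/(J x y) muleN muleA -EFinM mulVf ?mul1e//.
by rewrite gt_eqF.
Qed.

Let integral_tilted x y :
  \int[lambda]_z tilted ((x, y), z) = expeR (- lne (J x y)) * J x y.
Proof.
rewrite -expeR_soft -ge0_integralZl//.
- exact: (measurable_fun_pair2 (x, y) mW).
- by move=> z _; exact: expeR_ge0.
- exact: expeR_ge0.
Qed.

Lemma integral_tilted_pos x y : soft_cost eps psi lambda x y != +oo ->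
  \int[lambda]_z tilted ((x, y), z) = 1.
Proof.
move=> sy; rewrite integral_tilted; move: sy; rewrite /soft_cost -/(J x y).
case: (J x y) (J_lty x y) (J_ge0 x y) => [r| |]// _; rewrite lee_fin le_eqVlt.
move=> /predU1P[<-|r0 _]; first by rewrite /= lexx gt0_muleNy ?lte_fin.
by rewrite expeRN_lne// -EFinM mulVf// gt_eqF.
Qed.

(** When [J x y = 0] the tilt is the product of [+oo] and of an integrand that
    vanishes almost everywhere, hence has integral 0. *)
Lemma integral_tilted_le1 x y : \int[lambda]_z tilted ((x, y), z) <= 1.
Proof.
have [sy|sy] := eqVneq (soft_cost eps psi lambda x y) +oo; last first.
  by rewrite integral_tilted_pos.
rewrite integral_tilted; suff -> : J x y = 0 by rewrite mule0.
move: sy; rewrite /soft_cost -/(J x y).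
case: (J x y) (J_lty x y) (J_ge0 x y) => [r| |]// _; rewrite lee_fin le_eqVlt.
by move=> /predU1P[<-//|r0]; rewrite lne_EFin.
Qed.

Lemma tilted_fin_num t : soft_cost eps psi lambda t.1.1 t.1.2 != +oo ->
  tilted t \is a fin_num.
Proof.
move=> sy; rewrite ge0_fin_numE ?tilted_ge0// /tilted /tilt.
apply: lte_mul_pinfty; rewrite ?expeR_ge0//.
  rewrite ge0_fin_numE ?expeR_ge0// ltey expeR_eqy.
  case: (soft_cost _ _ _ _ _) sy (soft_cost_neqNy t.1.1 t.1.2) => //.
exact: W_lty.
Qed.

End soft_kernel.

(** * Comparison of the two energies of a law of triples *)

Section density_lemmas.
Context d (T : measurableType d) (R : realType).

Lemma dominates_ae (m n : probability T R) (P : T -> Prop) :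
  m `<< n -> {ae n, forall x, P x} -> {ae m, forall x, P x}.
Proof.
move=> /null_content_dominatesP mn [N [mN N0 sN]].
by exists N; split => //; exact: mn.
Qed.

Lemma density_trans (m n k : probability T R) p q :
  density m n p -> density n k q -> density m k (fun x => p x * q x)%R.
Proof.
move=> [mp p0 mE] nq; case: (nq) => mq q0 _; split.
- exact: measurable_funM.
- by move=> x; exact: mulr_ge0.
move=> A mA; rewrite mE// [LHS]integral_indicator [RHS]integral_indicator.
rewrite (integral_density nq).
- by apply: eq_integral => x _; rewrite EFinM muleAC.
- apply: emeasurable_funM; [exact/measurable_EFinP|exact: measurable_indicator].
- by move=> x; rewrite mule_ge0 ?lee_fin.
Qed.

End density_lemmas.

Section measure_lemmas.
Context d d' (T : measurableType d) (U : measurableType d') (R : realType).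

Lemma probability_image (Q : probability T R) (phi : T -> U) :
  measurable_fun setT phi ->
  exists m : probability U R,
    forall A, measurable A -> Q (phi @^-1` A) = m A.
Proof.
move=> mphi; pose mix := isMeasurableFun.Build _ _ _ _ _ mphi.
pose X : {mfun T >-> U} := HB.pack phi mix.
by exists (distribution Q X).
Qed.

Lemma product_measure_fst (m : probability T R) (n : probability U R) A :
  measurable A -> (m \x n) (@fst T U @^-1` A) = m A.
Proof.
move=> mA; have -> : @fst T U @^-1` A = A `*` setT.
  by apply/seteqP; split => [x /= ?|x []].
by rewrite product_measure1E// [X in _ * X](probability_setT n) mule1.
Qed.

Lemma product_measure_snd (m : probability T R) (n : probability U R) A :
  measurable A -> (m \x n) (@snd T U @^-1` A) = n A.
Proof.
move=> mA; have -> : @snd T U @^-1` A = setT `*` A.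
  by apply/seteqP; split => [x /= ?|x []].
by rewrite product_measure1E// [X in X * _](probability_setT m) mul1e.
Qed.

(** Almost everywhere for a coupling of [mu] and [eta], the density of [eta] is
    positive, hence the reference measure of the second factor can be replaced
    by [eta]. *)
Lemma coupling_dominates (m : probability (T * U)%type R) (mu : probability T R)
    (eta lambda : probability U R) h :
  couplings mu eta m -> density eta lambda h ->
  m `<< mu \x lambda -> m `<< mu \x eta.
Proof.
move=> [_ m2] hd ml; have [mh h0 _] := hd.
have [_ _ PE] := density_product_snd mu hd.
apply: dominates_measure0 => B mB B0.
have mf : measurable_fun setT (fun t : T * U => (h t.2)%:E * (\1_B t)%:E).
  apply: emeasurable_funM; last exact: measurable_indicator.
  by apply/measurable_EFinP; exact: measurableT_comp.
have hB : {ae mu \x lambda, forall t : T * U, (h t.2)%:E * (\1_B t)%:E = 0}.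
  have : ae_eq (mu \x lambda) setT
      (fun t : T * U => (h t.2)%:E * (\1_B t)%:E) (cst 0).
    apply/ae_eq_integral_abs => //.
    have <- := etrans (esym (PE _ mB)) B0; rewrite [RHS]integral_indicator.
    by apply: eq_integral => t _; rewrite gee0_abs// mule_ge0 ?lee_fin.
  by apply: filterS => t /(_ I).
have hpos : {ae m, forall t, (0 < h t.2)%R}.
  have [N [mN N0 sN]] := density_ae_gt0 hd.
  exists (@snd T U @^-1` N); split.
  - exact: measurable_preimageT measurable_snd mN.
  - by rewrite -N0; exact: m2.
  - by move=> t /= ht; exact: sN.
have : {ae m, forall t, ~ B t}.
  have hB' := dominates_ae ml hB.
  apply: filterS2 hB' hpos => t e ht Bt; move: e.
  by rewrite indicE mem_set// mule1 => -[e]; rewrite e ltxx in ht.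
move=> [N [mN N0 sN]].
apply/eqP; rewrite eq_le measure_ge0 andbT -N0 le_measure ?inE//.
by move=> t Bt; apply: sN => /=; exact.
Qed.

End measure_lemmas.

Section bridge.
Context dX dZ (X : measurableType dX) (Z : measurableType dZ) (R : realType).
Variables (eps : R) (psi : X -> Z -> \bar R) (lambda : probability Z R).
Variables mu nu : probability X R.
Hypothesis eps_gt0 : (0 < eps)%R.
Hypothesis psi_meas : jointly_measurable psi.
Hypothesis psiNNy : forall x z, psi x z != -oo.
Hypothesis lambda_int : forall x,
  \int[lambda]_z expeR (- ((2 / eps)%:E * psi x z)) < +oo.

Let split_energy (p1 p2 : X * Z -> R) (h : Z -> R) (t : (X * X) * Z) : \bar R :=
  psi t.1.1 t.2 + psi t.1.2 t.2 + eps%:E * lne (p1 (xz t))%:E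
  + eps%:E * lne (p2 (yz t))%:E + eps%:E * lne (h t.2)%:E.

Let soft_energy (g : X * X -> R) (t : (X * X) * Z) : \bar R :=
  soft_cost eps psi lambda t.1.1 t.1.2 + eps%:E * lne (g t.1)%:E.

Let measurable_lne_density d (T : measurableType d) (m n : probability T R) p :
  density m n p -> measurable_fun setT (fun x => lne (p x)%:E).
Proof.
by case=> mp _ _; apply: (measurableT_comp (@measurable_lne R));
  exact/measurable_EFinP.
Qed.

Let mxz := @measurable_xz _ _ X Z.
Let myz := @measurable_yz _ _ X Z.

Let lne_density_image d (T : measurableType d) (m n : probability T R) p
    (Q : probability ((X * X) * Z)%type R) phi :
  density m n p -> measurable_fun setT phi ->
  (forall A, measurable A -> Q (phi @^-1` A) = m A) ->
  [/\ measurable_fun setT (fun t => eps%:E * lne (p (phi t))%:E),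
      well_defined_integral Q (fun t => eps%:E * lne (p (phi t))%:E)
    & \int[Q]_t (eps%:E * lne (p (phi t))%:E) = eps%:E * \int[m]_x lne (p x)%:E].
Proof.
move=> mp mphi QE; have ml := measurable_lne_density mp.
have mlphi : measurable_fun setT (fun t => lne (p (phi t))%:E).
  exact: (measurableT_comp ml mphi).
split.
- exact: emeasurable_funM.
- apply: well_defined_integralZl => //.
  apply: (well_defined_integral_image mphi QE ml).
  exact: well_defined_lne_density mp.
- by rewrite integral_gt0Zl// (integral_image mphi QE ml).
Qed.

(** The energies of the marginals of [Q] are integrals against [Q] itself, where
    they can be compared pointwise. *)
Section coupled.
Variables (Q : probability ((X * X) * Z)%type R).
Variables (pi : probability (X * X)%type R) (eta : probability Z R).
Variables (m1 m2 : probability (X * Z)%type R).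
Variables (g : X * X -> R) (p1 p2 : X * Z -> R) (h : Z -> R).
Hypothesis Qpi : forall A, measurable A -> Q (fst @^-1` A) = pi A.
Hypothesis Qeta : forall A, measurable A -> Q (snd @^-1` A) = eta A.
Hypothesis Q1 : forall A, measurable A -> Q (xz @^-1` A) = m1 A.
Hypothesis Q2 : forall A, measurable A -> Q (yz @^-1` A) = m2 A.
Hypothesis pid : density pi (mu \x nu) g.
Hypothesis d1 : density m1 (mu \x eta) p1.
Hypothesis d2 : density m2 (nu \x eta) p2.
Hypothesis etad : density eta lambda h.
Hypothesis wd1 : well_defined_integral m1 (fun p => psi p.1 p.2).
Hypothesis wd2 : well_defined_integral m2 (fun p => psi p.1 p.2).
Hypothesis wdpi :
  well_defined_integral pi (fun p => soft_cost eps psi lambda p.1 p.2).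

Let integral_split_energy : [/\ measurable_fun setT (split_energy p1 p2 h),
  well_defined_integral Q (split_energy p1 p2 h)
  & \int[Q]_t split_energy p1 p2 h t = \int[m1]_p psi p.1 p.2 + \int[m2]_p psi p.1 p.2
      + eps%:E * \int[m1]_x lne (p1 x)%:E + eps%:E * \int[m2]_x lne (p2 x)%:E
      + eps%:E * \int[eta]_z lne (h z)%:E].
Proof.
have [mp1 wp1 Ep1] := lne_density_image d1 mxz Q1.
have [mp2 wp2 Ep2] := lne_density_image d2 myz Q2.
have [mh wh Eh] := lne_density_image etad (@measurable_snd _ _ (X * X)%type Z) Qeta.
have ms1 := measurable_cost_xz psi_meas.
have ms2 := measurable_cost_yz psi_meas.
have ws1 : well_defined_integral Q (fun t : X * X * Z => psi t.1.1 t.2).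
  exact: (well_defined_integral_image mxz Q1 psi_meas wd1).
have ws2 : well_defined_integral Q (fun t : X * X * Z => psi t.1.2 t.2).
  exact: (well_defined_integral_image myz Q2 psi_meas wd2).
have m12 : measurable_fun setT
    (fun t : X * X * Z => psi t.1.1 t.2 + psi t.1.2 t.2).
  exact: emeasurable_funD.
have w12 := well_defined_integralD ms1 ms2 ws1 ws2.
have m123 := emeasurable_funD m12 mp1.
have w123 := well_defined_integralD m12 mp1 w12 wp1.
have m1234 := emeasurable_funD m123 mp2.
have w1234 := well_defined_integralD m123 mp2 w123 wp2.
split.
- exact: emeasurable_funD.
- exact: well_defined_integralD.
rewrite (integralD_well_defined m1234 mh w1234 wh) Eh; congr (_ + _).
rewrite (integralD_well_defined m123 mp2 w123 wp2) Ep2; congr (_ + _).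
rewrite (integralD_well_defined m12 mp1 w12 wp1) Ep1; congr (_ + _).
rewrite (integralD_well_defined ms1 ms2 ws1 ws2).
by rewrite (integral_image mxz Q1 psi_meas) (integral_image myz Q2 psi_meas).
Qed.

Let integral_soft_energy : [/\ measurable_fun setT (soft_energy g),
  well_defined_integral Q (soft_energy g)
  & \int[Q]_t soft_energy g t = \int[pi]_p soft_cost eps psi lambda p.1 p.2
      + eps%:E * \int[pi]_x lne (g x)%:E].
Proof.
have mf := @measurable_fst _ _ (X * X)%type Z.
have [mg wg Eg] := lne_density_image pid mf Qpi.
have ms := @measurable_soft_cost _ _ X Z R eps psi lambda psi_meas.
have msf := measurableT_comp ms mf.
have ws := well_defined_integral_image mf Qpi ms wdpi.
split.
- exact: emeasurable_funD.
- exact: well_defined_integralD.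
rewrite (integralD_well_defined msf mg ws wg) Eg; congr (_ + _).
by rewrite (integral_image mf Qpi ms).
Qed.

Let tilted := tilted eps psi lambda.
Let M := (mu \x nu) \x lambda.

Lemma soft_energy_le : density Q M (fun t => p1 (xz t) * p2 (yz t) * h t.2)%R ->
  \int[pi]_p soft_cost eps psi lambda p.1 p.2 + eps%:E * \int[pi]_x lne (g x)%:E
  <= \int[m1]_p psi p.1 p.2 + \int[m2]_p psi p.1 p.2
      + eps%:E * \int[m1]_x lne (p1 x)%:E + eps%:E * \int[m2]_x lne (p2 x)%:E
      + eps%:E * \int[eta]_z lne (h z)%:E.
Proof.
move=> Qd; have [mS wS <-] := integral_split_energy.
have [mG wG <-] := integral_soft_energy.
have [mg g0 gE] := pid; have [_ p10 _] := d1; have [_ p20 _] := d2.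
have [_ h0 _] := etad.
have mg1 : measurable_fun setT (fun t : X * X * Z => (g t.1)%:E).
  by apply/measurable_EFinP; exact: (measurableT_comp mg measurable_fst).
have mt := @measurable_tilted _ _ X Z R eps psi lambda psi_meas.
have mb : measurable_fun setT (fun t => (g t.1)%:E * tilted t).
  exact: emeasurable_funM.
have b0 t : 0 <= (g t.1)%:E * tilted t.
  by rewrite mule_ge0 ?tilted_ge0// lee_fin.
apply: (gibbs_inequality eps_gt0 Qd mb b0) => //.
  rewrite (integral_product_fst (mu \x nu) lambda mb b0).
  apply: (@le_trans _ _ (\int[mu \x nu]_x (g x)%:E)); last first.
    by rewrite -gE// [leLHS](probability_setT pi).
  apply: ge0_le_integral => //.
  - by move=> x _; apply: integral_ge0.
  - exact: (measurable_integral_snd lambda mb b0).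
  - exact/measurable_EFinP.
  move=> [x y] _; rewrite /= ge0_integralZl//.
  - rewrite -[leRHS]mule1 lee_wpmul2l ?lee_fin//.
    exact: integral_tilted_le1.
  - exact: (measurable_fun_pair2 (x, y) mt).
  - by move=> z _; exact: tilted_ge0.
  - by rewrite lee_fin.
move=> t at0; apply: tilt_le => //.
exact: soft_cost_neqNy.
Qed.

Lemma soft_energy_ge :
  couplings nu eta m2 ->
  density Q M (fun t => g t.1 * fine (tilted t))%R ->
  \int[m1]_p psi p.1 p.2 + \int[m2]_p psi p.1 p.2
      + eps%:E * \int[m1]_x lne (p1 x)%:E + eps%:E * \int[m2]_x lne (p2 x)%:E
      + eps%:E * \int[eta]_z lne (h z)%:E <=
  \int[pi]_p soft_cost eps psi lambda p.1 p.2 + eps%:E * \int[pi]_x lne (g x)%:E.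
Proof.
move=> c2 Qd; have [mS wS <-] := integral_split_energy.
have [mG wG <-] := integral_soft_energy.
have [mg g0 gE] := pid; have [_ p10 _] := d1; have [_ p20 _] := d2.
have [mh h0 _] := etad.
have mq := measurable_gluing_density d1 d2.
have q0 t : (0 <= p1 (xz t) * p2 (yz t))%R by exact: mulr_ge0.
pose b t := (p1 (xz t) * p2 (yz t) * h t.2)%:E.
have mb : measurable_fun setT b.
  apply/measurable_EFinP; apply: measurable_funM => //.
  exact: (measurableT_comp mh measurable_snd).
have b0 t : 0 <= b t by rewrite lee_fin mulr_ge0.
apply: (gibbs_inequality eps_gt0 Qd mb b0) => //.
  rewrite -(integral_gluing_density c2 d1 d2).
  have Pd := density_product_snd (mu \x nu) etad.
  rewrite (integral_density Pd); last 2 first.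
  - exact/measurable_EFinP.
  - by move=> t; rewrite lee_fin.
  by under eq_integral do rewrite /b EFinM.
move=> t at0; apply: tilt_ge => //.
exact: soft_cost_neqNy.
Qed.

End coupled.
End bridge.

(** * Exchanging couplings of the marginals and couplings with a latent law *)

Section two_bounds.
Context dX dZ (X : measurableType dX) (Z : measurableType dZ) (R : realType).
Variables (eps : R) (psi : X -> Z -> \bar R) (lambda : probability Z R).
Variables mu nu : probability X R.
Hypothesis eps_gt0 : (0 < eps)%R.
Hypothesis psi_meas : jointly_measurable psi.
Hypothesis psiNNy : forall x z, psi x z != -oo.
Hypothesis lambda_int : forall x,
  \int[lambda]_z expeR (- ((2 / eps)%:E * psi x z)) < +oo.

Let soft := soft_cost eps psi lambda.

(** The gluing of [m1] and [m2] that makes [x] and [y] independent given [z] has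
    a marginal on [(x, y)] at least as good for the soft cost. *)
Lemma soft_le_split (eta : probability Z R) (m1 m2 : probability (X * Z)%type R) :
  couplings mu eta m1 -> couplings nu eta m2 ->
  m1 `<< mu \x eta -> m2 `<< nu \x eta -> eta `<< lambda ->
  well_defined_integral m1 (fun p => psi p.1 p.2) ->
  well_defined_integral m2 (fun p => psi p.1 p.2) ->
  (forall pi, couplings mu nu pi ->
     well_defined_integral pi (fun p => soft p.1 p.2)) ->
  exists2 pi, couplings mu nu pi &
    \int[pi]_p soft p.1 p.2 + eps%:E * KL pi (mu \x nu) <=
    \int[m1]_p psi p.1 p.2 + eps%:E * KL m1 (mu \x eta)
    + (\int[m2]_p psi p.1 p.2 + eps%:E * KL m2 (nu \x eta))
    + eps%:E * KL eta lambda.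
Proof.
move=> c1 c2 dom1 dom2 dom wd1 wd2 wdpi.
have [p1 d1 ->] := KL_density dom1; have [p2 d2 ->] := KL_density dom2.
have [h etad ->] := KL_density dom.
have [Q [Qd Q1 Q2]] := gluing c1 c2 d1 d2.
have {}Qd := density_trans Qd (density_product_snd (mu \x nu) etad).
have [pi Qpi] := probability_image Q (@measurable_fst _ _ (X * X)%type Z).
have cpi : couplings mu nu pi.
  split=> A mA.
  - apply: etrans (esym (Qpi _ (measurable_preimageT measurable_fst mA))) _.
    exact: etrans (Q1 _ (measurable_preimageT measurable_fst mA)) (proj1 c1 _ mA).
  - apply: etrans (esym (Qpi _ (measurable_preimageT measurable_snd mA))) _.
    exact: etrans (Q2 _ (measurable_preimageT measurable_fst mA)) (proj1 c2 _ mA).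
have Qeta A : measurable A -> Q (snd @^-1` A) = eta A.
  move=> mA; apply: etrans (proj2 c1 _ mA).
  exact: Q1 _ (measurable_preimageT measurable_snd mA).
have dompi : pi `<< mu \x nu.
  apply: dominates_measure0 => A mA A0; rewrite -Qpi//.
  have /null_content_dominatesP Qdom := density_dominates Qd.
  apply: Qdom; first exact: measurable_preimageT measurable_fst mA.
  by rewrite -A0; exact: (product_measure_fst (mu \x nu) lambda).
have [g pid KLpi] := KL_density dompi.
exists pi => //; rewrite KLpi.
have := soft_energy_le eps_gt0 psi_meas psiNNy lambda_int Qpi Qeta Q1 Q2 pid d1 d2
  etad wd1 wd2 (wdpi _ cpi) Qd.
move=> /le_trans; apply; apply: leeD => //.
by rewrite [leRHS]addeACA addeA.
Qed.

(** Drawing [z] from the Gibbs law given [(x, y)] lifts [pi] to triples; the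
    finiteness of the soft cost ensures that this law exists for [pi]-almost all
    [(x, y)], which are those with [J x y <> 0]. *)
Lemma split_le_soft (pi : probability (X * X)%type R) :
  couplings mu nu pi -> pi `<< mu \x nu ->
  well_defined_integral pi (fun p => soft p.1 p.2) ->
  \int[pi]_p soft p.1 p.2 < +oo ->
  (forall eta m, couplings mu eta m ->
     well_defined_integral m (fun p => psi p.1 p.2)) ->
  (forall eta m, couplings nu eta m ->
     well_defined_integral m (fun p => psi p.1 p.2)) ->
  exists eta m1 m2, [/\ couplings mu eta m1, couplings nu eta m2 &
    \int[m1]_p psi p.1 p.2 + eps%:E * KL m1 (mu \x eta)
    + (\int[m2]_p psi p.1 p.2 + eps%:E * KL m2 (nu \x eta))
    + eps%:E * KL eta lambda <=
    \int[pi]_p soft p.1 p.2 + eps%:E * KL pi (mu \x nu)].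
Proof.
move=> cpi dompi wdpi piy wdmu wdnu.
have [g pid KLpi] := KL_density dompi.
have [mg g0 _] := pid.
pose K := tilted eps psi lambda.
have mK : measurable_fun setT K by exact: measurable_tilted.
have mfK : measurable_fun setT (fun t => fine (K t)).
  exact: measurableT_comp.
have fK0 t : (0 <= fine (K t))%R by rewrite fine_ge0// tilted_ge0.
have mgt : measurable_fun setT (fun t : X * X * Z => g t.1).
  exact: (measurableT_comp mg measurable_fst).
pose a t := (g t.1 * fine (K t))%R.
have ma : measurable_fun setT a by exact: measurable_funM.
have a0 t : (0 <= a t)%R by exact: mulr_ge0.
have ms : measurable_fun setT (fun p : X * X => soft p.1 p.2).
  exact: measurable_soft_cost.
have softfin := well_defined_integral_fin_num ms wdpi piy.
have K1 x y : soft x y \is a fin_num -> \int[lambda]_z (fine (K ((x, y), z)))%:E = 1.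
  move=> sxy.
  have sy : soft x y != +oo by apply: contraTneq sxy => ->.
  rewrite -(integral_tilted_pos eps_gt0 psi_meas psiNNy lambda_int sy).
  by apply: eq_integral => z _; rewrite fineK// tilted_fin_num.
(* Integrating out [z] in the density [a] leaves [g]. *)
have aA (F : X * X -> \bar R) : measurable_fun setT F -> (forall x, 0 <= F x) ->
    \int[(mu \x nu) \x lambda]_t (F t.1 * (a t)%:E) = \int[pi]_x F x.
  move=> mF F0.
  have mF1 : measurable_fun setT (fun t : X * X * Z => F t.1).
    exact: (measurableT_comp mF measurable_fst).
  have meK : measurable_fun setT (fun t => (fine (K t))%:E).
    exact/measurable_EFinP.
  have mN := measurable_integral_snd lambda meK (fun t => fK0 t).
  rewrite (integral_product_fst (mu \x nu) lambda); last 2 first.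
  - by apply: emeasurable_funM => //; exact/measurable_EFinP.
  - by move=> t; rewrite mule_ge0// lee_fin.
  transitivity (\int[mu \x nu]_x
      (F x * (\int[lambda]_z (fine (K (x, z)))%:E) * (g x)%:E)).
    apply: eq_integral => x _; rewrite muleAC -ge0_integralZl//.
    - by apply: eq_integral => z _; rewrite /a EFinM muleA.
    - exact: (measurable_fun_pair2 x meK).
    - by move=> z _; rewrite lee_fin.
    - by rewrite mule_ge0 ?lee_fin.
  rewrite -(integral_density pid); last 2 first.
  - exact: emeasurable_funM.
  - by move=> x; apply: mule_ge0 => //; apply: integral_ge0 => z _; rewrite lee_fin.
  apply: ae_eq_integral => //.
  - exact: emeasurable_funM.
  - by apply: filterS softfin => -[x y] sxy _; rewrite K1 ?mule1.
have a1 : \int[(mu \x nu) \x lambda]_t (a t)%:E = 1.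
  rewrite -(integral_probability_cst pi 1) -(aA (cst 1))//.
  by apply: eq_integral => t _; rewrite mul1e.
have [Q Qd] := probability_of_density ma a0 a1.
have Qpi A : measurable A -> Q (fst @^-1` A) = pi A.
  move=> mA; have [_ _ QE] := Qd.
  rewrite QE; last exact: measurable_preimageT measurable_fst mA.
  rewrite integral_indicator -(integral_indicatorT pi)//.
  rewrite -(aA (fun x => (\1_A x)%:E)).
  - by apply: eq_integral => t _; rewrite muleC.
  - exact: measurable_indicator.
  - by move=> x; rewrite lee_fin.
have [eta Qeta] := probability_image Q (@measurable_snd _ _ (X * X)%type Z).
have [m1 Q1] := probability_image Q (@measurable_xz _ _ X Z).
have [m2 Q2] := probability_image Q (@measurable_yz _ _ X Z).
have c1 : couplings mu eta m1.
  split=> A mA.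
  - apply: etrans (esym (Q1 _ (measurable_preimageT measurable_fst mA))) _.
    exact: etrans (Qpi _ (measurable_preimageT measurable_fst mA)) (proj1 cpi _ mA).
  - apply: etrans (esym (Q1 _ (measurable_preimageT measurable_snd mA))) _.
    exact: Qeta _ mA.
have c2 : couplings nu eta m2.
  split=> A mA.
  - apply: etrans (esym (Q2 _ (measurable_preimageT measurable_fst mA))) _.
    exact: etrans (Qpi _ (measurable_preimageT measurable_snd mA)) (proj2 cpi _ mA).
  - apply: etrans (esym (Q2 _ (measurable_preimageT measurable_snd mA))) _.
    exact: Qeta _ mA.
have /null_content_dominatesP Qdom := density_dominates Qd.
have dom : eta `<< lambda.
  apply: dominates_measure0 => A mA A0; rewrite -Qeta//.
  apply: Qdom; first exact: measurable_preimageT measurable_snd mA.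
  by rewrite -A0; exact: (product_measure_snd (mu \x nu) lambda).
have [h etad KLeta] := KL_density dom.
have dom1 : m1 `<< mu \x eta.
  apply: (coupling_dominates c1 etad); apply: dominates_measure0 => A mA A0.
  rewrite -Q1//; apply: Qdom.
    exact: measurable_preimageT (@measurable_xz _ _ X Z) mA.
  by rewrite -A0; exact: product_measure_xz.
have dom2 : m2 `<< nu \x eta.
  apply: (coupling_dominates c2 etad); apply: dominates_measure0 => A mA A0.
  rewrite -Q2//; apply: Qdom.
    exact: measurable_preimageT (@measurable_yz _ _ X Z) mA.
  by rewrite -A0; exact: product_measure_yz.
have [p1 d1 KL1] := KL_density dom1; have [p2 d2 KL2] := KL_density dom2.
exists eta, m1, m2; split => //; rewrite KLpi KL1 KL2 KLeta.
have := soft_energy_ge eps_gt0 psi_meas psiNNy lambda_int Qpi Qeta Q1 Q2 pid d1 d2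
  etad (wdmu _ _ c1) (wdnu _ _ c2) wdpi c2 Qd.
apply: le_trans; apply: leeD => //.
by rewrite [leLHS]addeACA addeA.
Qed.

End two_bounds.

(** * Infima: the transport costs *)

Section infima.
Variable R : realType.
Implicit Types (A : set (\bar R)) (K L : \bar R).

Lemma adde_neqNy (x y : \bar R) : x != -oo -> y != -oo -> x + y != -oo.
Proof. by move=> xN yN; rewrite adde_eq_ninfty negb_or xN. Qed.

Lemma le_ereal_infDr A K L : ereal_inf A != -oo -> K != -oo ->
  (forall x, A x -> L <= x + K) -> L <= ereal_inf A + K.
Proof.
move=> AN; case: K => [k| |]// _ LA; last by rewrite addey// leey.
rewrite -leeBlDr//; apply/ereal_infP => x Ax.
by rewrite leeBlDr// LA.
Qed.

Lemma ereal_infDr A K : ereal_inf A != -oo -> K != -oo ->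
  ereal_inf [set x + K | x in A] = ereal_inf A + K.
Proof.
move=> AN KN; apply/eqP; rewrite eq_le; apply/andP; split.
  apply: le_ereal_infDr => // x Ax; apply: ereal_inf_lbound.
  by exists x.
apply/ereal_infP => _ [x Ax <-].
by rewrite leeD2r// ereal_inf_lbound.
Qed.

End infima.

Section transport_split.
Context dX dZ (X : measurableType dX) (Z : measurableType dZ) (R : realType).
Variables (eps : R) (psi : X -> Z -> \bar R) (lambda : probability Z R).
Hypothesis eps_gt0 : (0 < eps)%R.
Hypothesis psi_meas : jointly_measurable psi.
Hypothesis psiNNy : forall x z, psi x z != -oo.
Hypothesis lambda_int : forall x,
  \int[lambda]_z expeR (- ((2 / eps)%:E * psi x z)) < +oo.

Lemma scaled_KL_neqNy d (T : measurableType d) (m n : probability T R) :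
  eps%:E * KL m n != -oo.
Proof.
have : 0 <= eps%:E * KL m n by rewrite mule_ge0 ?KL_ge0// lee_fin ltW.
by case: (_ * _).
Qed.

Lemma scaled_KL_pinfty d (T : measurableType d) (m n : probability T R) :
  ~ (m `<< n) -> eps%:E * KL m n = +oo.
Proof.
move=> mn; rewrite /KL; case: asboolP => // _.
by rewrite gt0_muley ?lte_fin.
Qed.

Theorem OT_soft_cost (mu nu : probability X R) :
  OT_well_defined eps (soft_cost eps psi lambda) mu nu ->
  (forall eta, OT_well_defined eps psi mu eta) ->
  (forall eta, OT_well_defined eps psi nu eta) ->
  OT eps (soft_cost eps psi lambda) mu nu =
  ereal_inf [set OT eps psi mu eta + OT eps psi nu eta + eps%:E * KL eta lambda
            | eta in [set: probability Z R]].
Proof.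
move=> [wds OTs] wmu wnu.
have term_neqNy (rho : probability X R) (eta : probability Z R)
      (m : probability (X * Z)%type R) :
    well_defined_integral m (fun p => psi p.1 p.2) ->
    \int[m]_p psi p.1 p.2 + eps%:E * KL m (rho \x eta) != -oo.
  move=> wd; apply: adde_neqNy; first exact: well_defined_integral_neqNy.
  exact: scaled_KL_neqNy.
apply/eqP; rewrite eq_le; apply/andP; split.
  apply/ereal_infP => _ [eta _ <-].
  have [wd1 N1] := wmu eta; have [wd2 N2] := wnu eta.
  have [dom|dom] := pselect (eta `<< lambda); last first.
    rewrite scaled_KL_pinfty// addey ?leey//.
    exact: adde_neqNy.
  set L := OT eps _ mu nu; rewrite -addeA [X in X + _]/OT.
  apply: le_ereal_infDr; first exact: N1.
    by apply: adde_neqNy; [exact: N2|exact: scaled_KL_neqNy].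
  move=> _ [m1 c1 <-]; rewrite addeCA [X in X + _]/OT.
  apply: le_ereal_infDr; first exact: N2.
    apply: adde_neqNy; last exact: scaled_KL_neqNy.
    exact/term_neqNy/wd1.
  move=> _ [m2 c2 <-].
  have [dom1|dom1] := pselect (m1 `<< mu \x eta); last first.
    rewrite (scaled_KL_pinfty dom1) [X in _ + (X + _)]addey; last first.
      exact/well_defined_integral_neqNy/wd1.
    rewrite addye ?scaled_KL_neqNy// addey ?leey//.
    by apply: term_neqNy; exact: wd2.
  have [dom2|dom2] := pselect (m2 `<< nu \x eta); last first.
    rewrite (scaled_KL_pinfty dom2) [X in X + _]addey; last first.
      exact/well_defined_integral_neqNy/wd2.
    rewrite addye ?leey//; apply: adde_neqNy; last exact: scaled_KL_neqNy.
    by apply: term_neqNy; exact: wd1.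
  have [pi cpi le_pi] := soft_le_split eps_gt0 psi_meas psiNNy lambda_int
    c1 c2 dom1 dom2 dom (wd1 _ c1) (wd2 _ c2) wds.
  rewrite addeCA addeA; apply: le_trans le_pi.
  by apply: ereal_inf_lbound; exists pi.
apply/ereal_infP => _ [pi cpi <-].
have [dom|dom] := pselect (pi `<< mu \x nu); last first.
  rewrite (scaled_KL_pinfty dom) addey ?leey//.
  exact/well_defined_integral_neqNy/wds.
have [sy|sy] := eqVneq (\int[pi]_p soft_cost eps psi lambda p.1 p.2) +oo.
  by rewrite sy addye ?leey// scaled_KL_neqNy.
have sly : \int[pi]_p soft_cost eps psi lambda p.1 p.2 < +oo by rewrite ltey.
have [eta [m1 [m2 [c1 c2 le_pi]]]] := split_le_soft eps_gt0 psi_meas psiNNy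
  lambda_int cpi dom (wds _ cpi) sly (fun eta => (wmu eta).1)
  (fun eta => (wnu eta).1).
apply: le_trans le_pi.
apply: (@le_trans _ _
    (OT eps psi mu eta + OT eps psi nu eta + eps%:E * KL eta lambda)).
  by apply: ereal_inf_lbound; exists eta.
apply: leeD => //; apply: leeD; apply: ereal_inf_lbound.
- by exists m1.
- by exists m2.
Qed.

End transport_split.

Section potentials.
Context d (X : measurableType d) (R : realType).
Variables (eps : R) (s c : X -> X -> \bar R) (u : X -> \bar R).
Hypothesis eps_gt0 : (0 < eps)%R.
Hypothesis s_meas : jointly_measurable s.
Hypothesis u_meas : measurable_fun setT u.
Hypothesis cE : forall x y, c x y = s x y + eps%:E * u x + eps%:E * u y.

(** The integral of a sum of two potentials is the same for all couplings of
    the same marginals, hence it comes out of the infimum. *)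
Lemma OT_add_potentials (mu nu : probability X R) :
  well_defined_integral mu u -> well_defined_integral nu u ->
  OT_well_defined eps s mu nu ->
  OT eps c mu nu =
  OT eps s mu nu + eps%:E * \int[mu]_x u x + eps%:E * \int[nu]_x u x.
Proof.
move=> wmu wnu [wds OTs].
have pot_neqNy (rho : probability X R) : well_defined_integral rho u ->
    eps%:E * \int[rho]_x u x != -oo.
  move=> wrho; rewrite -integral_gt0Zl//.
  by apply: well_defined_integral_neqNy; exact: well_defined_integralZl.
rewrite -addeA -ereal_infDr//; last first.
  by apply: adde_neqNy; exact: pot_neqNy.
rewrite image_comp; congr ereal_inf; apply: eq_imagel => pi cpi /=.
have mfst := @measurable_fst _ _ X X; have msnd := @measurable_snd _ _ X X.
have [pi1 pi2] := cpi.
have mu1 : measurable_fun setT (fun p : X * X => eps%:E * u p.1).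
  by apply: emeasurable_funM => //; exact: measurableT_comp.
have mu2 : measurable_fun setT (fun p : X * X => eps%:E * u p.2).
  by apply: emeasurable_funM => //; exact: measurableT_comp.
have m1 : measurable_fun setT (fun p : X * X => u p.1) by exact: measurableT_comp.
have m2 : measurable_fun setT (fun p : X * X => u p.2) by exact: measurableT_comp.
have w1 : well_defined_integral pi (fun p => eps%:E * u p.1).
  apply: well_defined_integralZl => //.
  exact: (well_defined_integral_image mfst pi1 u_meas wmu).
have w2 : well_defined_integral pi (fun p => eps%:E * u p.2).
  apply: well_defined_integralZl => //.
  exact: (well_defined_integral_image msnd pi2 u_meas wnu).
have ws := wds _ cpi.
under eq_integral do rewrite cE.
rewrite (integralD_well_defined (emeasurable_funD s_meas mu1) mu2
  (well_defined_integralD s_meas mu1 ws w1) w2).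
rewrite (integralD_well_defined s_meas mu1 ws w1) !integral_gt0Zl//.
rewrite -(integral_image mfst pi1 u_meas) -(integral_image msnd pi2 u_meas).
by rewrite -!addeA (addeC (eps%:E * KL _ _)) -!addeA.
Qed.

End potentials.

(** With [F x i = K x + a x i + k i / 2], the function [C x y] is the infimum over
    [i] of [F x i + F y i], which is at least [inf F x + inf F y], that is half
    the sum of the two diagonal values.  The value [+oo] of [C x y] makes the
    dual difference [+oo]; otherwise some index makes all the terms finite. *)
Lemma inf_sum_debiasable (R : realType) (T I : Type) (C : T -> T -> \bar R)
    (K : T -> \bar R) (a : T -> I -> \bar R) (k : I -> \bar R) :
  (forall x y, C x y != -oo) -> (forall x, K x != -oo) ->
  (forall x i, a x i != -oo) -> (forall i, 0 <= k i) ->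
  (forall x y, C x y = K x + K y + ereal_inf [set a x i + a y i + k i | i in setT]) ->
  debiasable C.
Proof.
move=> CN KN aN k0 CE; split => //.
  move=> x y; rewrite !CE [in LHS](addeC (K x)); congr (_ + ereal_inf _).
  by apply: eq_imagel => i _; rewrite (addeC (a x i)).
move=> x y.
have Cdiag t i : C t t <= K t + K t + (a t i + a t i + k i).
  by rewrite CE; apply: leeD => //; apply: ereal_inf_lbound; exists i.
have [Cy|Cy] := eqVneq (C x y) +oo.
  by rewrite Cy; apply: leey.
have [Kxy Iy] : K x + K y \is a fin_num /\
    ereal_inf [set a x i + a y i + k i | i in setT] < +oo.
  move: Cy (CN x y); rewrite CE.
  move: (ereal_inf _) => J.
  case: (K x) (KN x) => [p| |]// _; case: (K y) (KN y) => [q| |]// _;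
    case: J => [j| |]//=; by rewrite ?ltry.
have [Kx Ky] : K x \is a fin_num /\ K y \is a fin_num.
  by move: Kxy; rewrite fin_numD => /andP.
have fin_diag t : (K t \is a fin_num) -> (exists i, a t i + k i < +oo) ->
    C t t \is a fin_num.
  move=> Kt [i iy]; rewrite fin_numE CN/= -ltey.
  apply: (le_lt_trans (Cdiag t i)).
  move: iy (k0 i) (aN t i); case: (a t i) => [p| |]//; case: (k i) => [q| |]//.
  by case: (K t) Kt => [r| |]// _ _ _ _; rewrite ltry.
have bound i : a x i + a y i + k i < +oo ->
    [/\ C x x \is a fin_num, C y y \is a fin_num &
     (2^-1)%:E * C x x + (2^-1)%:E * C y y - (K x + K y) <= a x i + a y i + k i].
  move=> iy.
  have [px qy rk] : [/\ a x i \is a fin_num, a y i \is a fin_num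
      & k i \is a fin_num].
    move: (aN x i) (aN y i) (k0 i) iy.
    by case: (a x i) => [p| |]; case: (a y i) => [q| |]; case: (k i) => [r| |].
  have diag t : K t \is a fin_num -> a t i \is a fin_num -> C t t \is a fin_num.
    move=> Kt ti; apply: fin_diag => //.
    by exists i; rewrite -(fineK ti) -(fineK rk) ltry.
  have Cx := diag x Kx px; have Cyy := diag y Ky qy.
  split => //.
  move: (Cdiag x i) (Cdiag y i).
  rewrite -(fineK Cx) -(fineK Cyy) -(fineK Kx) -(fineK Ky) -(fineK px) -(fineK qy).
  by rewrite -(fineK rk) /= !lee_fin => h1 h2; lra.
have [_ [i _ <-] iy] := ereal_inf_lt Iy.
have [Cx Cyy _] := bound i iy.
have : (2^-1)%:E * C x x + (2^-1)%:E * C y y <= C x y.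
  rewrite [leRHS]CE [leRHS]addeC -leeBlDr//.
  apply/ereal_infP => _ [j _ <-].
  have [jy|jy] := eqVneq (a x j + a y j + k j) +oo; first by rewrite jy leey.
  by have [] := bound j; rewrite ?ltey.
move: (CN x y) Cy; case: (C x y) => [r| |]// _ _.
case: (C x x) Cx => [cx| |]// _; case: (C y y) Cyy => [cy| |]// _.
by rewrite /= !lee_fin => h; lra.
Qed.

(** Taking logarithms in the factorization of the kernel.  The cases of a zero
    kernel, due to an infinite potential or to [J = 0], make both sides [+oo]. *)
Lemma gibbs_kernel_cost (R : realType) (eps : R) (C J a b : \bar R) :
  (0 < eps)%R -> C != -oo -> 0 < a -> 0 < b -> 0 <= J ->
  - (eps%:E * lne J) != -oo ->
  expeR (- (eps^-1%:E * C)) = (a * b)^-1 * J ->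
  C = - (eps%:E * lne J) + eps%:E * lne a + eps%:E * lne b.
Proof.
move=> e0 CN a0 b0 J0 JN kE.
have eV0 : (0 < eps^-1)%R by rewrite invr_gt0.
have lneN (t : \bar R) : 0 < t -> eps%:E * lne t != -oo.
  case: t => [t| |]// t0; first by rewrite lne_EFin.
  by rewrite /= gt0_muley ?lte_fin.
have Coo : (a * b)^-1 * J = 0 -> C = +oo.
  move=> k0; move: kE; rewrite k0 => /eqP; rewrite expeR_eq0.
  by case: C CN => [r| |].
case: a a0 kE Coo => [a| |]// a0 kE Coo; last first.
  rewrite Coo; last by rewrite gt0_mulye// invey mul0e.
  by rewrite [lne +oo]/= gt0_muley ?lte_fin// addey// addye// lneN.
case: b b0 kE Coo => [b| |]// b0 kE Coo; last first.
  rewrite Coo; last by rewrite gt0_muley// invey mul0e.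
  rewrite [lne +oo]/= gt0_muley ?lte_fin// addey// adde_neqNy// lneN//.
move: J0; rewrite le_eqVlt => /predU1P[J0|J0].
  rewrite Coo -J0 ?mule0// (le0_lneNy (lexx 0)) gt0_muleNy ?lte_fin//.
  by rewrite [- -oo]/= !addye// lneN.
case: J JN J0 kE {Coo} => [J| |]// JN J0; last first.
  by rewrite [lne _]/= gt0_muley ?lte_fin in JN.
rewrite !lte_fin in a0 b0 J0.
rewrite inver mulf_eq0 !gt_eqF//= -EFinM => kE.
have := congr1 (@lne R) kE.
rewrite expeRK !lne_EFin ?mulr_gt0 ?invr_gt0 ?mulr_gt0//.
rewrite lnM ?posrE ?invr_gt0 ?mulr_gt0// lnV ?posrE ?mulr_gt0// lnM ?posrE//.
case: C CN {kE} => [C| |]// _; last by rewrite gt0_muley ?lte_fin.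
move=> [] CE; rewrite !leNgt J0 a0 b0 /=.
have -> : C = (- (eps * (- (eps^-1 * C))))%R by field; rewrite gt_eqF.
by rewrite CE; congr (_%:E); ring.
Qed.

Theorem corollary4p8 (R : realType) (X Z : ptopologicalType)
  (polishX : polish R X) (polishZ : polish R Z)
  (eps : R) (eps_gt0 : (0 < eps)%R)
  (c : borel X -> borel X -> \bar R)
  (c_meas : jointly_measurable c)
  (c_debiasable : debiasable c)
  (psi : borel X -> borel Z -> \bar R)
  (psi_meas : jointly_measurable psi)
  (psiNNy : forall x z, psi x z != -oo)
  (c_psi : inf_representation psi c)
  (lambda : probability (borel Z) R)
  (lambda_int : forall x,
     \int[lambda]_z expeR (- ((2 / eps)%:E * psi x z)) < +oo)
  (f : borel X -> \bar R)
  (f_meas : measurable_fun [set: borel X] f)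
  (f_gt0 : forall x, 0 < f x)
  (k_f : forall x y, gibbs_kernel eps c x y =
     (f x * f y)^-1 *
     \int[lambda]_z expeR (- (eps^-1%:E * (psi x z + psi y z)))) :
  (forall mu nu : probability (borel X) R,
     well_posed eps psi lambda f mu nu ->
     OT eps c mu nu =
       OT eps (soft_cost eps psi lambda) mu nu
       + eps%:E * \int[mu]_x lne (f x) + eps%:E * \int[nu]_x lne (f x)
     /\
     OT eps c mu nu =
       eps%:E * \int[mu]_x lne (f x) + eps%:E * \int[nu]_x lne (f x)
       + ereal_inf [set OT eps psi mu eta + OT eps psi nu eta
                          + eps%:E * KL eta lambda
                   | eta in [set: probability (borel Z) R]])
  /\
  ((forall mu nu : probability (borel X) R,
      well_posed eps psi lambda f mu nu) ->
   debiasable (fun mu nu : probability (borel X) R => OT eps c mu nu)).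
Proof.
have cN x y : c x y != -oo by have [] := c_debiasable.
have cE x y : c x y =
    soft_cost eps psi lambda x y + eps%:E * lne (f x) + eps%:E * lne (f y).
  apply: (gibbs_kernel_cost eps_gt0 (cN x y) (f_gt0 x) (f_gt0 y) _ _ (k_f x y)).
    by apply: integral_ge0 => z _; exact: expeR_ge0.
  exact: (soft_cost_neqNy eps_gt0 psi_meas psiNNy lambda_int).
have mlnf : measurable_fun setT (fun x => lne (f x)).
  exact: (measurableT_comp (@measurable_lne R) f_meas).
have formula1 (mu nu : probability (borel X) R) :
    well_posed eps psi lambda f mu nu ->
    OT eps c mu nu = OT eps (soft_cost eps psi lambda) mu nu
      + eps%:E * \int[mu]_x lne (f x) + eps%:E * \int[nu]_x lne (f x).
  move=> [wmu wnu wsoft _].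
  apply: (OT_add_potentials eps_gt0 _ mlnf cE wmu wnu wsoft).
  exact: (measurable_soft_cost eps lambda psi_meas).
have formula2 (mu nu : probability (borel X) R) :
    well_posed eps psi lambda f mu nu ->
    OT eps c mu nu =
      eps%:E * \int[mu]_x lne (f x) + eps%:E * \int[nu]_x lne (f x)
      + ereal_inf [set OT eps psi mu eta + OT eps psi nu eta
                         + eps%:E * KL eta lambda
                  | eta in [set: probability (borel Z) R]].
  move=> wp; rewrite formula1//; have [_ _ wsoft wpsi] := wp.
  rewrite (OT_soft_cost eps_gt0 psi_meas psiNNy lambda_int wsoft
    (fun eta => (wpsi eta).1) (fun eta => (wpsi eta).2)).
  by rewrite -addeA addeC.
split=> [mu nu wp|wp]; first by split; [exact: formula1|exact: formula2].
have KN (mu : probability (borel X) R) : eps%:E * \int[mu]_x lne (f x) != -oo.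
  have [wmu _ _ _] := wp mu mu; rewrite -integral_gt0Zl//.
  by apply: well_defined_integral_neqNy; exact: well_defined_integralZl.
apply: (@inf_sum_debiasable R (probability (borel X) R)
  (probability (borel Z) R) _ (fun mu => eps%:E * \int[mu]_x lne (f x))
  (fun mu eta => OT eps psi mu eta) (fun eta => eps%:E * KL eta lambda)) => //.
- move=> mu nu; rewrite formula1//; have [_ _ [_ OTN] _] := wp mu nu.
  by apply: adde_neqNy => //; exact: adde_neqNy.
- by move=> mu eta; have [_ _ _ /(_ eta)[[_ OTN] _]] := wp mu mu.
- by move=> eta; rewrite mule_ge0 ?KL_ge0// lee_fin ltW.
- by move=> mu nu; exact: formula2.
Qed.
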